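(* Let $k$ be a field and $Q$ a finite quiver. Every short exact sequence in $\mathsf{qgr}(kQ)$ splits.
   Context: $Q$ is a finite quiver (finite directed graph; loops and multiple arrows allowed); its path algebra $kQ$ is $\mathbb{N}$-graded by path length and is left coherent. $\mathsf{gr}(kQ)$ is the abelian category of finitely presented $\mathbb{Z}$-graded left $kQ$-modules with degree-preserving homomorphisms, $\mathsf{fdim}(kQ)$ is its full subcategory of finite-dimensional modules, and $\mathsf{qgr}(kQ)=\mathsf{gr}(kQ)/\mathsf{fdim}(kQ)$ is the quotient abelian category. The path algebra convention is that $pq$ denotes the path $q$ followed by the path $p$. *)

(* Defs.v *)
From HB Require Import structures.
From mathcomp Require Import all_boot all_order all_algebra finmap.
From mathcomp Require Import monalg.

Set Implicit Arguments.
Unset Strict Implicit.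
Unset Printing Implicit Defensive.

Import GRing.Theory.
Local Open Scope ring_scope.

(* Categories whose hom-sets are setoids: [heq] is equality of morphisms. *)
Record category := Category {
  obj :> Type;
  mor : obj -> obj -> Type;
  heq : forall x y, mor x y -> mor x y -> Prop;
  idm : forall x, mor x x;
  compm : forall x y z, mor y z -> mor x y -> mor x z;
  heq_refl : forall x y (f : mor x y), heq f f;
  heq_sym : forall x y (f g : mor x y), heq f g -> heq g f;
  heq_trans : forall x y (f g h : mor x y), heq f g -> heq g h -> heq f h;
  heq_comp : forall x y z (g g' : mor y z) (f f' : mor x y),
    heq g g' -> heq f f' -> heq (compm g f) (compm g' f');
  comp_idl : forall x y (f : mor x y), heq (compm (idm y) f) f;
  comp_idr : forall x y (f : mor x y), heq (compm f (idm x)) f;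
  comp_assoc : forall x y z t (h : mor z t) (g : mor y z) (f : mor x y),
    heq (compm h (compm g f)) (compm (compm h g) f) }.

Arguments mor {c} x y.
Arguments heq {c x y} f g.
Arguments idm {c} x.
Arguments compm {c x y z} g f.

Declare Scope cat_scope.
Delimit Scope cat_scope with cat.
Notation "f == g" := (heq f g) : cat_scope.
Notation "g \o f" := (compm g f) : cat_scope.

Section CategoryNotions.
Variable C : category.
Implicit Types X Y Z T A B K : C.
Local Open Scope cat_scope.

Definition is_zero_obj Z : Prop :=
  (forall X, exists f : mor Z X, forall g, g == f) /\
  (forall X, exists f : mor X Z, forall g, g == f).

Definition is_zero_mor X Y (f : mor X Y) : Prop :=
  exists Z, is_zero_obj Z /\
    exists (a : mor X Z) (b : mor Z Y), f == b \o a.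

Definition is_kernel K X Y (i : mor K X) (f : mor X Y) : Prop :=
  is_zero_mor (f \o i) /\
  forall T (t : mor T X), is_zero_mor (f \o t) ->
    exists u : mor T K, i \o u == t /\ forall u', i \o u' == t -> u' == u.

Definition is_cokernel X Y K (f : mor X Y) (p : mor Y K) : Prop :=
  is_zero_mor (p \o f) /\
  forall T (t : mor Y T), is_zero_mor (t \o f) ->
    exists u : mor K T, u \o p == t /\ forall u', u' \o p == t -> u' == u.

Definition short_exact X Y Z (f : mor X Y) (g : mor Y Z) : Prop :=
  is_kernel f g /\ is_cokernel f g.

Definition is_product A B Y (p : mor Y A) (q : mor Y B) : Prop :=
  forall T (a : mor T A) (b : mor T B), exists u : mor T Y,
    (p \o u == a /\ q \o u == b) /\
    forall u', p \o u' == a -> q \o u' == b -> u' == u.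

Definition is_coproduct A B Y (i : mor A Y) (j : mor B Y) : Prop :=
  forall T (a : mor A T) (b : mor B T), exists u : mor Y T,
    (u \o i == a /\ u \o j == b) /\
    forall u', u' \o i == a -> u' \o j == b -> u' == u.

Definition is_direct_sum A B Y (i : mor A Y) (j : mor B Y)
    (p : mor Y A) (q : mor Y B) : Prop :=
  [/\ p \o i == idm A, q \o j == idm B,
      is_zero_mor (q \o i), is_zero_mor (p \o j) &
      is_product p q /\ is_coproduct i j].

(* X -f-> Y -g-> Z is the direct sum sequence of X and Z: this includes the
   existence of a section of g and of a retraction of f. *)
Definition splits X Y Z (f : mor X Y) (g : mor Y Z) : Prop :=
  exists (s : mor Z Y) (r : mor Y X), is_direct_sum f s r g.

End CategoryNotions.

(* The localization C[W^-1]: morphisms are formal composites of morphisms of C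
   and of formal inverses of morphisms in W, modulo the congruence [zz_eq]. *)
Section Localization.
Variables (C : category) (W : forall x y : C, mor x y -> Prop).
Local Open Scope cat_scope.

Inductive zigzag : C -> C -> Type :=
| zz_mor x y (f : mor x y) : zigzag x y
| zz_inv x y (w : mor x y) of W w : zigzag y x
| zz_comp x y z (g : zigzag y z) (f : zigzag x y) : zigzag x z.

Inductive zz_eq : forall x y, zigzag x y -> zigzag x y -> Prop :=
| zz_refl x y (f : zigzag x y) : zz_eq f f
| zz_sym x y (f g : zigzag x y) of zz_eq f g : zz_eq g f
| zz_trans x y (f g h : zigzag x y) of zz_eq f g & zz_eq g h : zz_eq f h
| zz_congr x y z (g g' : zigzag y z) (f f' : zigzag x y)
    of zz_eq g g' & zz_eq f f' : zz_eq (zz_comp g f) (zz_comp g' f')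
| zz_assoc x y z t (h : zigzag z t) (g : zigzag y z) (f : zigzag x y) :
    zz_eq (zz_comp h (zz_comp g f)) (zz_comp (zz_comp h g) f)
| zz_idl x y (f : zigzag x y) : zz_eq (zz_comp (zz_mor (idm y)) f) f
| zz_idr x y (f : zigzag x y) : zz_eq (zz_comp f (zz_mor (idm x))) f
| zz_mor_eq x y (f g : mor x y) of f == g : zz_eq (zz_mor f) (zz_mor g)
| zz_mor_comp x y z (g : mor y z) (f : mor x y) :
    zz_eq (zz_mor (g \o f)) (zz_comp (zz_mor g) (zz_mor f))
| zz_invl x y (w : mor x y) (Ww : W w) :
    zz_eq (zz_comp (zz_inv Ww) (zz_mor w)) (zz_mor (idm x))
| zz_invr x y (w : mor x y) (Ww : W w) :
    zz_eq (zz_comp (zz_mor w) (zz_inv Ww)) (zz_mor (idm y)).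

Definition localization : category :=
  @Category C zigzag zz_eq (fun x => zz_mor (idm x)) zz_comp
    zz_refl zz_sym zz_trans zz_congr zz_idl zz_idr zz_assoc.

End Localization.

(* The quotient C/B of an abelian category C by a Serre subcategory B (given
   by its objects) is the localization of C at the morphisms whose kernel and
   cokernel lie in B. *)
Definition iso_modulo (C : category) (B : C -> Prop) (X Y : C) (f : mor X Y) :=
  (exists (K : C) (i : mor K X), B K /\ is_kernel i f) /\
  (exists (L : C) (p : mor Y L), B L /\ is_cokernel f p).

Definition quotient_category (C : category) (B : C -> Prop) : category :=
  localization (@iso_modulo C B).

Record quiver := Quiver {
  vertex : finType;
  arrow : finType;
  src : arrow -> vertex;
  tgt : arrow -> vertex }.

Section Paths.
Variable Q : quiver.

Fixpoint is_walk (v : vertex Q) (s : seq (arrow Q)) : bool :=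
  if s is a :: s' then (src a == v) && is_walk (tgt a) s' else true.

Fixpoint walk_end (v : vertex Q) (s : seq (arrow Q)) : vertex Q :=
  if s is a :: s' then walk_end (tgt a) s' else v.

(* A path is its starting vertex with the list of its arrows in the order in
   which they are traversed; (v, [::]) is the trivial path at v. *)
Record qpath := QPath {
  pval : vertex Q * seq (arrow Q);
  _ : is_walk pval.1 pval.2 }.

HB.instance Definition _ := [isSub for pval].
HB.instance Definition _ := [Countable of qpath by <:].

Definition psrc (p : qpath) := (pval p).1.
Definition parrows (p : qpath) := (pval p).2.
Definition ptgt (p : qpath) := walk_end (psrc p) (parrows p).
Definition plen (p : qpath) := size (parrows p).

Definition ptriv (v : vertex Q) : qpath := @QPath (v, [::]) isT.

Lemma is_walk_cat v s t :
  is_walk v (s ++ t) = is_walk v s && is_walk (walk_end v s) t.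
Proof. by elim: s v => //= a s IH v; rewrite IH andbA. Qed.

Lemma walk_end_cat v s t : walk_end v (s ++ t) = walk_end (walk_end v s) t.
Proof. by elim: s v => //=. Qed.

(* [pcat p q] is the path "q followed by p", when q ends where p starts; the
   [insub] then succeeds, see [pcatP]. *)
Definition pcat (p q : qpath) : option qpath :=
  if ptgt q == psrc p then insub (psrc q, parrows q ++ parrows p) else None.

Lemma pcatP p q : ptgt q = psrc p ->
  exists2 r, pcat p q = Some r & pval r = (psrc q, parrows q ++ parrows p).
Proof.
move=> e; rewrite /pcat e eqxx; case: insubP => [r _ er|]; first by exists r.
by rewrite is_walk_cat (valP q) -/(psrc q) -/(parrows q) -/(ptgt q) e (valP p).
Qed.

Lemma pcat_psrc p q r : pcat p q = Some r -> psrc r = psrc q.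
Proof.
by rewrite /pcat; case: ifP => // _; case: insubP => //= u _ eu [<-];
  rewrite {1}/psrc -/(val u) eu.
Qed.

Lemma pcat_ptgt p q r : pcat p q = Some r -> ptgt r = ptgt p.
Proof.
rewrite /pcat; case: eqP => // e; case: insubP => //= u _ eu [<-].
by rewrite /ptgt /psrc /parrows eu walk_end_cat -/(ptgt q) e.
Qed.

Lemma pcatA p q r :
  obind (fun s => pcat p s) (pcat q r) = obind (fun s => pcat s r) (pcat p q).
Proof.
case: (ptgt r =P psrc q) => [e1|ne1]; last first.
  rewrite [pcat q r]/pcat (introF eqP ne1) /=.
  case e: (pcat p q) => [s|] //=.
  by rewrite /pcat (pcat_psrc e) (introF eqP ne1).
case: (ptgt q =P psrc p) => [e2|ne2]; last first.
  rewrite [pcat p q]/pcat (introF eqP ne2) /=.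
  case e: (pcat q r) => [s|] //=.
  by rewrite /pcat (pcat_ptgt e) (introF eqP ne2).
have [s es vs] := pcatP e1; have [t et vt] := pcatP e2.
rewrite es et /=.
have e3 : ptgt s = psrc p by rewrite (pcat_ptgt es).
have e4 : ptgt r = psrc t by rewrite (pcat_psrc et).
have [u -> vu] := pcatP e3; have [w -> vw] := pcatP e4.
congr Some; apply: val_inj; rewrite /= vu vw.
by rewrite /psrc /parrows vs vt /= catA.
Qed.

End Paths.

Section PathAlgebra.
Variables (k : fieldType) (Q : quiver).
Local Notation path := (qpath Q).

(* Finite formal k-linear combinations of paths. *)
Definition path_algebra : Type := {malg k[path]}.
HB.instance Definition _ := GRing.Lmodule.on path_algebra.

End PathAlgebra.

(* [pa_basis] and [pa_mul] are sealed: otherwise unification unfolds them down to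
   the finmap and choiceType encodings. *)
HB.lock Definition pa_basis (k : fieldType) (Q : quiver) (p : qpath Q) :
  path_algebra k Q := << p >>.

HB.lock Definition pa_mul (k : fieldType) (Q : quiver) (x y : path_algebra k Q) :
    path_algebra k Q :=
  \sum_(p <- msupp x) \sum_(q <- msupp y)
    (x@_p * y@_q) *: (if pcat p q is Some r then pa_basis k r else 0).

Section PathAlgebraTheory.
Variables (k : fieldType) (Q : quiver).
Local Notation path := (qpath Q).
Local Notation path_algebra := (path_algebra k Q).
Local Notation pa_basis := (@pa_basis k Q).
Local Notation pa_mul := (@pa_mul k Q).
Implicit Types x y z : path_algebra.

Definition pa_bmul (p q : path) : path_algebra :=
  if pcat p q is Some r then pa_basis r else 0.

Definition pa_one : path_algebra := \sum_v pa_basis (ptriv v).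

Lemma pa_mulw (d1 d2 : {fset path}) x y :
  (msupp x `<=` d1)%fset -> (msupp y `<=` d2)%fset ->
  pa_mul x y = \sum_(p <- d1) \sum_(q <- d2) (x@_p * y@_q) *: pa_bmul p q.
Proof.
move=> le1 le2; rewrite pa_mul.unlock (big_fset_incl _ le1) /=; last first.
  by move=> p _ /mcoeff_outdom xp; rewrite big1 // => q _; rewrite xp mul0r scale0r.
apply/eq_bigr=> p _; apply/big_fset_incl => // q _ /mcoeff_outdom ->.
by rewrite mulr0 scale0r.
Qed.

Lemma pa_mulDl : left_distributive pa_mul +%R.
Proof.
move=> x y z.
rewrite (pa_mulw (msuppD_le x y) (fsubset_refl _)).
rewrite (pa_mulw (fsubsetUl _ (msupp y)) (fsubset_refl (msupp z))).
rewrite (pa_mulw (fsubsetUr (msupp x) _) (fsubset_refl (msupp z))).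
rewrite -big_split /=; apply/eq_bigr=> p _.
rewrite -big_split /=; apply/eq_bigr=> q _.
by rewrite mcoeffD mulrDl scalerDl.
Qed.

Lemma pa_mulDr : right_distributive pa_mul +%R.
Proof.
move=> z x y.
rewrite (pa_mulw (fsubset_refl _) (msuppD_le x y)).
rewrite (pa_mulw (fsubset_refl (msupp z)) (fsubsetUl _ (msupp y))).
rewrite (pa_mulw (fsubset_refl (msupp z)) (fsubsetUr (msupp x) _)).
rewrite -big_split /=; apply/eq_bigr=> p _.
rewrite -big_split /=; apply/eq_bigr=> q _.
by rewrite mcoeffD mulrDr scalerDl.
Qed.

Lemma pa_mul0l y : pa_mul 0 y = 0.
Proof. by rewrite pa_mul.unlock msupp0 big_seq_fset0. Qed.

Lemma pa_mul0r x : pa_mul x 0 = 0.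
Proof. by rewrite pa_mul.unlock big1 // => p _; rewrite msupp0 big_seq_fset0. Qed.

Lemma pa_mulZl c x y : pa_mul (c *: x) y = c *: pa_mul x y.
Proof.
rewrite (pa_mulw (msuppZ_le c x) (fsubset_refl _)) pa_mul.unlock scaler_sumr.
apply/eq_bigr=> p _; rewrite scaler_sumr; apply/eq_bigr=> q _.
by rewrite mcoeffZ scalerA mulrA.
Qed.

Lemma pa_mulZr c x y : pa_mul x (c *: y) = c *: pa_mul x y.
Proof.
rewrite (pa_mulw (fsubset_refl _) (msuppZ_le c y)) pa_mul.unlock scaler_sumr.
apply/eq_bigr=> p _; rewrite scaler_sumr; apply/eq_bigr=> q _.
by rewrite mcoeffZ scalerA mulrCA.
Qed.

Lemma pa_mul_suml (I : Type) (r : seq I) (F : I -> path_algebra) y :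
  pa_mul (\sum_(i <- r) F i) y = \sum_(i <- r) pa_mul (F i) y.
Proof.
exact: (big_morph (pa_mul^~ y) (fun _ _ => pa_mulDl _ _ _) (pa_mul0l y)).
Qed.

Lemma pa_mul_sumr (I : Type) (r : seq I) (F : I -> path_algebra) x :
  pa_mul x (\sum_(i <- r) F i) = \sum_(i <- r) pa_mul x (F i).
Proof.
exact: (big_morph (pa_mul x) (fun _ _ => pa_mulDr _ _ _) (pa_mul0r x)).
Qed.

Lemma pa_mulbb p q : pa_mul (pa_basis p) (pa_basis q) = pa_bmul p q.
Proof.
rewrite {1 2}pa_basis.unlock (pa_mulw (@msuppU_le _ _ p 1) (@msuppU_le _ _ q 1)).
by rewrite !big_seq_fset1 !mcoeffUU mulr1 scale1r.
Qed.

Lemma pa_basisE x : x = \sum_(p <- msupp x) x@_p *: pa_basis p.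
Proof.
rewrite [LHS]monalgE pa_basis.unlock; apply/eq_bigr=> p _.
by apply/malgP=> q; rewrite [RHS]mcoeffZ [LHS]mcoeffU [X in _ * X]mcoeffU mulr_natr.
Qed.

Lemma pa_mul_linl a x x' y :
  pa_mul (a *: x + x') y = a *: pa_mul x y + pa_mul x' y.
Proof. exact: etrans (pa_mulDl _ _ _) (congr1 (+%R^~ _) (pa_mulZl _ _ _)). Qed.

Lemma pa_mul_linr a x x' y :
  pa_mul y (a *: x + x') = a *: pa_mul y x + pa_mul y x'.
Proof. exact: etrans (pa_mulDr _ _ _) (congr1 (+%R^~ _) (pa_mulZr _ _ _)). Qed.

Lemma pa_ext (F G : path_algebra -> path_algebra) :
  (forall a x x', F (a *: x + x') = a *: F x + F x') ->
  (forall a x x', G (a *: x + x') = a *: G x + G x') ->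
  (forall p, F (pa_basis p) = G (pa_basis p)) -> F =1 G.
Proof.
move=> linF linG eFG x; rewrite (pa_basisE x).
have lin0 (H : path_algebra -> path_algebra) :
    (forall a x x', H (a *: x + x') = a *: H x + H x') -> H 0 = 0.
  by move=> /(_ (-1) 0 0); rewrite scaler0 addr0 scaleN1r addNr.
elim: (X in \sum_(p <- X) _) => [|p s IH].
  by rewrite big_nil (lin0 F linF) (lin0 G linG).
by rewrite big_cons linF linG eFG IH.
Qed.

Lemma pa_mulA : associative pa_mul.
Proof.
move=> x y z; move: x.
apply: pa_ext => [a x x'|a x x'|p].
- exact: pa_mul_linl.
- exact: etrans (congr1 (pa_mul^~ z) (pa_mul_linl _ _ _ _)) (pa_mul_linl _ _ _ _).
move: y; apply: pa_ext => [a x x'|a x x'|q].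
- exact: etrans (congr1 (pa_mul _) (pa_mul_linl _ _ _ _)) (pa_mul_linr _ _ _ _).
- exact: etrans (congr1 (pa_mul^~ z) (pa_mul_linr _ _ _ _)) (pa_mul_linl _ _ _ _).
move: z; apply: pa_ext => [a x x'|a x x'|r].
- exact: etrans (congr1 (pa_mul _) (pa_mul_linr _ _ _ _)) (pa_mul_linr _ _ _ _).
- exact: pa_mul_linr.
apply: etrans (congr1 (pa_mul _) (pa_mulbb q r)) _.
apply: etrans (esym (congr1 (pa_mul^~ _) (pa_mulbb p q))).
rewrite /pa_bmul; have := pcatA p q r.
case: (pcat q r) => [s|]; case: (pcat p q) => [t|] /= e.
- apply: etrans (pa_mulbb _ _) (etrans _ (esym (pa_mulbb _ _))).
  by rewrite /pa_bmul e.
- by apply: etrans (pa_mulbb _ _) _; rewrite /pa_bmul e; apply/esym/pa_mul0l.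
- apply: etrans (pa_mul0r _) (etrans _ (esym (pa_mulbb _ _))).
  by rewrite /pa_bmul -e.
- exact: etrans (pa_mul0r _) (esym (pa_mul0l _)).
Qed.

Lemma pcat_trivl v (p : path) :
  pcat (ptriv v) p = if ptgt p == v then Some p else None.
Proof.
case: eqP => [e|ne]; last by rewrite /pcat (introF eqP ne).
have [r -> vr] := @pcatP Q (ptriv v) p e.
by congr Some; apply: val_inj; rewrite /= vr cats0 /psrc /parrows; case: (pval p).
Qed.

Lemma pcat_trivr v (p : path) :
  pcat p (ptriv v) = if v == psrc p then Some p else None.
Proof.
case: eqP => [e|ne]; last by rewrite /pcat /ptgt /= (introF eqP ne).
have [r -> vr] := @pcatP Q p (ptriv v) e.
by congr Some; apply: val_inj; rewrite /= vr /psrc /= e /psrc /parrows; case: (pval p).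
Qed.

Lemma pa_mul1l : left_id pa_one pa_mul.
Proof.
apply: pa_ext => [a x x'|//|p]; first exact: pa_mul_linr.
rewrite /pa_one pa_mul_suml (bigD1 (ptgt p)) //= pa_mulbb /pa_bmul.
rewrite pcat_trivl eqxx big1 ?addr0 // => v ne.
by rewrite pa_mulbb /pa_bmul pcat_trivl eq_sym (negbTE ne).
Qed.

Lemma pa_mul1r : right_id pa_one pa_mul.
Proof.
apply: pa_ext => [a x x'|//|p]; first exact: pa_mul_linl.
rewrite /pa_one pa_mul_sumr (bigD1 (psrc p)) //= pa_mulbb /pa_bmul.
rewrite pcat_trivr eqxx big1 ?addr0 // => v ne.
by rewrite pa_mulbb /pa_bmul pcat_trivr (negbTE ne).
Qed.

(* Only a [pzRingType]: the path algebra of the empty quiver is the zero ring.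
   For the same reason it is not an [algType k]; its k-algebra structure is
   [pa_scaleAl] and [pa_scaleAr]. *)
HB.instance Definition _ := GRing.Zmodule_isPzRing.Build path_algebra
  pa_mulA pa_mul1l pa_mul1r pa_mulDl pa_mulDr.

Lemma pa_scaleAl c x y : c *: (x * y) = (c *: x) * y.
Proof. by rewrite -[RHS]/(pa_mul _ _) pa_mulZl. Qed.

Lemma pa_scaleAr c x y : c *: (x * y) = x * (c *: y).
Proof. by rewrite -[RHS]/(pa_mul _ _) pa_mulZr. Qed.

Definition pa_homog (n : nat) x : Prop := forall p, p \in msupp x -> plen p = n.

End PathAlgebraTheory.

Section GradedModules.
Variables (k : fieldType) (Q : quiver).
Local Notation kQ := (path_algebra k Q).

(* [gdeg d] is the homogeneous component of degree d, and the module is the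
   direct sum of its homogeneous components. *)
Record grmod := GrMod {
  gmod :> lmodType kQ;
  gdeg : int -> gmod -> Prop;
  gdeg0 : forall d, gdeg d 0;
  gdegB : forall d x y, gdeg d x -> gdeg d y -> gdeg d (x - y);
  gdegM : forall n d (a : kQ) x,
    pa_homog n a -> gdeg d x -> gdeg (n%:Z + d) (a *: x);
  gdeg_span : forall x, exists (s : seq int) (c : int -> gmod),
    (forall d, gdeg d (c d)) /\ x = \sum_(d <- s) c d;
  gdeg_indep : forall (s : seq int) (c : int -> gmod), uniq s ->
    (forall d, gdeg d (c d)) -> \sum_(d <- s) c d = 0 ->
    forall d, d \in s -> c d = 0 }.

Record grhom (M N : grmod) := GrHom {
  ghom :> {linear M -> N};
  ghom_deg : forall d x, gdeg d x -> gdeg d (ghom x) }.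

Definition finitely_presented (M : lmodType kQ) : Prop :=
  exists (r : nat) (phi : {linear 'rV[kQ]_r -> M}),
    (forall y, exists x, phi x = y) /\
    exists (q : nat) (rel : 'I_q -> 'rV[kQ]_r), forall x,
      phi x = 0 <-> exists c : 'I_q -> kQ, x = \sum_i c i *: rel i.

(* k acts on a kQ-module through the scalars c *: 1 of kQ. *)
Definition finite_dimensional (M : lmodType kQ) : Prop :=
  exists (n : nat) (b : 'I_n -> M), forall x,
    exists c : 'I_n -> k, x = \sum_i (c i *: (1 : kQ)) *: b i.

Record fpgrmod := FpGrMod {
  fpgr :> grmod;
  fpgr_fp : finitely_presented fpgr }.

Definition grhom_eq (M N : fpgrmod) (f g : grhom M N) : Prop := f =1 g.

Definition grhom_id (M : fpgrmod) : grhom M M :=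
  @GrHom M M (idfun : {linear M -> M}) (fun _ _ Mx => Mx).

Definition grhom_comp (M N P : fpgrmod) (g : grhom N P) (f : grhom M N) :
    grhom M P :=
  @GrHom M P (ghom g \o ghom f : {linear M -> P})
    (fun d x Mx => ghom_deg g (ghom_deg f Mx)).

Lemma grhom_eq_comp (M N P : fpgrmod) (g g' : grhom N P) (f f' : grhom M N) :
  grhom_eq g g' -> grhom_eq f f' ->
  grhom_eq (grhom_comp g f) (grhom_comp g' f').
Proof. by move=> eg ef x /=; rewrite ef eg. Qed.

Definition gr : category :=
  @Category fpgrmod grhom grhom_eq grhom_id grhom_comp
    (fun _ _ _ _ => erefl) (fun _ _ _ _ e x => esym (e x))
    (fun _ _ _ _ _ e e' x => etrans (e x) (e' x)) grhom_eq_comp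
    (fun _ _ _ _ => erefl) (fun _ _ _ _ => erefl)
    (fun _ _ _ _ _ _ _ _ => erefl).

Definition fdim (M : gr) : Prop := finite_dimensional (M : fpgrmod).

Definition qgr : category := quotient_category fdim.

End GradedModules.

(* Main.v *)
(** In high degrees a finitely presented graded [kQ]-module [M] is free on its
    part of degree [n]: [M_{d+1}] is the direct sum of the [a e_{src a} M_d] over
    the arrows [a], for all [d >= n]. Indeed every path of positive length is
    uniquely an arrow times a path, so dividing the (finitely many) generators and
    relations of [M] on the left by the arrows shows that the failure of
    surjectivity or injectivity of multiplication by the arrows is
    finite-dimensional. Hence the tail [M_{>=n}] is finitely presented and
    projective, its inclusion in [M] becomes invertible in [qgr], and [qgr] is
    equivalent to the category of germs of graded morphisms defined on tails. A
    cokernel in [qgr] is then surjective on tails, so it has a section on a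
    projective tail; in the presence of a kernel this splits the sequence. *)

From HB Require Import structures.
From mathcomp Require Import all_boot all_order all_algebra finmap monalg boolp.
From mathcomp Require Import zify.
Require Import Defs.

Set Implicit Arguments.
Unset Strict Implicit.
Unset Printing Implicit Defensive.

Import GRing.Theory Num.Theory Order.TTheory.
Local Open Scope ring_scope.

(** * Left division by arrows in the path algebra *)

(** Morphisms of [qgr] are formal zigzags modulo generated relations, and exactness is stated by
    universal properties only; neither gives elements to compute with. Germs do. They are encoded as
    total functions with arbitrary values off a tail, and each argument uses finitely many
    conditions valid from some degree on, so it becomes a computation with elements at one common
    degree. Freeness of a tail is meant relative to the vertices: [M_{>=n}] is a direct sum of
    projectives [kQ e_v], one for each vector of a k-basis of [M_n] whose members each lie in some
    [e_v M]. Hence the idempotents that correct every lift and every coefficient. The two halves of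
    exactness are used differently. The cokernel is tested against a single object, the quotient of
    the target by the image of a tail. For the kernel, existence of factorizations yields the
    retraction and uniqueness yields its identities. *)

(* Sealed like [pa_basis] and [pa_mul], to keep failing unifications cheap. *)
HB.lock Definition pa_lin (k : fieldType) (Q : quiver)
    (f : qpath Q -> path_algebra k Q) (x : path_algebra k Q) : path_algebra k Q :=
  \sum_(p <- msupp x) x@_p *: f p.

HB.lock Definition kscal (k : fieldType) (Q : quiver) (c : k) : path_algebra k Q :=
  c *: (1 : path_algebra k Q).

Section PathAlgebraDerivations.
Variables (k : fieldType) (Q : quiver).
Local Notation path := (qpath Q).
Local Notation kQ := (path_algebra k Q).
Local Notation basis := (@pa_basis k Q).
Implicit Types (x y : kQ) (p q : path) (v w : vertex Q) (a b : arrow Q).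

Lemma pa_mulE x y : pa_mul x y = x * y. Proof. by []. Qed.

Lemma basis_coef p q : (basis p)@_q = (p == q)%:R.
Proof. by rewrite pa_basis.unlock mcoeffU. Qed.

Lemma coefD x y p : (x + y)@_p = x@_p + y@_p. Proof. exact: mcoeffD. Qed.

Lemma coefB x y p : (x - y)@_p = x@_p - y@_p. Proof. exact: mcoeffB. Qed.

Lemma coefZ c x p : (c *: x)@_p = c * x@_p. Proof. exact: mcoeffZ. Qed.

Lemma coef0 p : (0 : kQ)@_p = 0. Proof. exact: mcoeff0. Qed.

Lemma coef_sum (I : Type) (r : seq I) (F : I -> kQ) p :
  (\sum_(i <- r) F i)@_p = \sum_(i <- r) (F i)@_p.
Proof. exact: (big_morph _ (fun x y => coefD x y p) (coef0 p)). Qed.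

Lemma pa_eqP x y : (forall p, x@_p = y@_p) -> x = y.
Proof. by move=> e; apply/malgP. Qed.

Local Notation pa_lin := (@pa_lin k Q).
Local Notation kscal := (@kscal k Q).

Lemma pa_lin_coef f x q : (pa_lin f x)@_q = \sum_(p <- msupp x) x@_p * (f p)@_q.
Proof. by rewrite pa_lin.unlock coef_sum; apply: eq_bigr => p _; rewrite coefZ. Qed.

Lemma pa_linw (d : {fset path}) f x : (msupp x `<=` d)%fset ->
  pa_lin f x = \sum_(p <- d) x@_p *: f p.
Proof.
move=> le; rewrite pa_lin.unlock (big_fset_incl _ le) //= => p _ /mcoeff_outdom ->.
by rewrite scale0r.
Qed.

Lemma pa_linP f c x y : pa_lin f (c *: x + y) = c *: pa_lin f x + pa_lin f y.
Proof.
pose d := (msupp x `|` msupp y)%fset.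
have lx : (msupp x `<=` d)%fset by apply: fsubsetUl.
have ly : (msupp y `<=` d)%fset by apply: fsubsetUr.
have lxy : (msupp (c *: x + y) `<=` d)%fset.
  apply: fsubset_trans (msuppD_le _ _) _; apply: fsetUSS => //.
  exact: msuppZ_le.
rewrite !(pa_linw _ lx, pa_linw _ ly, pa_linw _ lxy) scaler_sumr -big_split /=.
by apply: eq_bigr => p _; rewrite coefD coefZ scalerDl scalerA.
Qed.

Lemma pa_lin_basis f p : pa_lin f (basis p) = f p.
Proof.
rewrite (@pa_linw [fset p]%fset) ?big_seq_fset1 ?basis_coef ?eqxx ?scale1r //.
by rewrite pa_basis.unlock; apply: msuppU_le.
Qed.

Lemma mulr_linr c x x' y : y * (c *: x + x') = c *: (y * x) + y * x'.
Proof. by rewrite mulrDr -pa_scaleAr. Qed.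

Definition parr a : path := @QPath Q (src a, [:: a]) (introT andP (conj (eqxx _) isT)).
Definition arr a : kQ := basis (parr a).
Definition idem v : kQ := basis (ptriv v).

Lemma path_lastP p : (exists v, p = ptriv v) \/
  (exists a q, ptgt q = src a /\ pcat (parr a) q = Some p).
Proof.
case: p => -[v s] ws /=; case/lastP: s ws => [|s a] ws.
  by left; exists v; apply: val_inj.
right; have: is_walk v (s ++ [:: a]) by rewrite cats1.
rewrite is_walk_cat /= => /and3P[w1 /eqP e1 _].
exists a, (@QPath Q (v, s) w1); split; first by rewrite /ptgt.
have [|r -> vr] := @pcatP Q (parr a) (@QPath Q (v, s) w1); first by rewrite /ptgt.
by congr Some; apply: val_inj; rewrite /= vr /parrows /= cats1.
Qed.

(* Products compose right to left, so stripping the final arrow [a] of a path is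
   left division by [a]; the other paths are sent to [0]. *)
Definition dlast a p : kQ :=
  if rev (parrows p) is b :: s then
    if b == a then
      if insub (psrc p, rev s) is Some q then basis q else 0
    else 0
  else 0.

Lemma dlast_triv a v : dlast a (ptriv v) = 0. Proof. by []. Qed.

Lemma dlast_cat a b p q : pcat (parr a) q = Some p ->
  dlast b p = if b == a then basis q else 0.
Proof.
move=> e; have e1 : ptgt q = psrc (parr a) by move: e; rewrite /pcat; case: eqP.
have [r] := pcatP e1; rewrite e => -[<-] vp.
rewrite /dlast /psrc /parrows vp /= cats1 rev_rcons eq_sym; case: ifP => // _.
by rewrite revK /psrc /parrows -surjective_pairing (valK q).
Qed.

Definition der a := pa_lin (dlast a).

Definition aug v x : k := x@_(ptriv v).

Lemma derP a c x y : der a (c *: x + y) = c *: der a x + der a y.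
Proof. exact: pa_linP. Qed.

Lemma der0 a : der a 0 = 0.
Proof. by have := derP a (-1) 0 0; rewrite scaler0 addr0 scaleN1r addNr. Qed.

Lemma derZ a c x : der a (c *: x) = c *: der a x.
Proof. by have := derP a c x 0; rewrite der0 [X in _ = X -> _]addr0 addr0. Qed.

Lemma derD a x y : der a (x + y) = der a x + der a y.
Proof. by have := derP a 1 x y; rewrite !scale1r. Qed.

Lemma der_sum (I : Type) (r : seq I) (F : I -> kQ) a :
  der a (\sum_(i <- r) F i) = \sum_(i <- r) der a (F i).
Proof. exact: (big_morph _ (derD a) (der0 a)). Qed.

Lemma der_idem a v : der a (idem v) = 0.
Proof. by rewrite /der pa_lin_basis. Qed.

Lemma der_cat a b p q : pcat (parr a) q = Some p ->
  der b (basis p) = if b == a then basis q else 0.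
Proof. by move=> e; rewrite /der pa_lin_basis (dlast_cat _ e). Qed.

Lemma basisM p q : basis p * basis q = pa_bmul k p q.
Proof. exact: pa_mulbb. Qed.

Lemma parr_mul a q : ptgt q = src a ->
  exists2 p, pcat (parr a) q = Some p & arr a * basis q = basis p.
Proof.
move=> e; have [p ep _] := @pcatP Q (parr a) q e.
by exists p => //; rewrite basisM /pa_bmul ep.
Qed.

Lemma parr_mul0 a q : ptgt q != src a -> arr a * basis q = 0.
Proof. by move=> ne; rewrite basisM /pa_bmul /pcat /psrc /= (negbTE ne). Qed.

Lemma idemM v q : idem v * basis q = if ptgt q == v then basis q else 0.
Proof. by rewrite basisM /pa_bmul pcat_trivl; case: ifP. Qed.

Lemma Midem v q : basis q * idem v = if v == psrc q then basis q else 0.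
Proof. by rewrite basisM /pa_bmul pcat_trivr; case: ifP. Qed.

Lemma idem_idem v w : idem v * idem w = if v == w then idem w else 0.
Proof. by rewrite idemM eq_sym. Qed.

Lemma sum_idem : \sum_v idem v = 1.
Proof. by []. Qed.

Lemma der_arr a b y : der b (arr a * y) = if b == a then idem (src a) * y else 0.
Proof.
move: y; apply: pa_ext => [c y y'|c y y'|q].
- by rewrite mulr_linr derP.
- by case: ifP => _; rewrite ?mulr_linr // scaler0 addr0.
rewrite idemM; have [e|ne] := eqVneq (ptgt q) (src a).
  by have [p ep ->] := parr_mul e; rewrite (der_cat _ ep).
by rewrite parr_mul0 // der0 if_same.
Qed.

Lemma idem_der a x : idem (src a) * der a x = der a x.
Proof.
move: x; apply: pa_ext => [c y y'|c y y'|p]; rewrite ?derP ?mulr_linr //.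
have [[v ->]|[b [q [e ep]]]] := path_lastP p; first by rewrite der_idem mulr0.
rewrite (der_cat _ ep); case: eqP => [eab|_]; last by rewrite mulr0.
by rewrite idemM e eab eqxx.
Qed.

(** A path is either trivial or has exactly one last arrow, so on each basis path a single summand
    survives. *)
Lemma pa_decomp x : x = \sum_v aug v x *: idem v + \sum_a arr a * der a x.
Proof.
have aP c y y' v : aug v (c *: y + y') = c * aug v y + aug v y'.
  by rewrite /aug coefD coefZ.
move: x; apply: pa_ext => [//|c y y'|p].
  rewrite scalerDr !scaler_sumr addrACA -[X in _ = X + _]big_split.
  rewrite -[X in _ = _ + X]big_split /=.
  congr (_ + _); apply: eq_bigr => i _; first by rewrite aP scalerDl scalerA.
  by rewrite derP mulr_linr.
have [[v ->]|[a [q [e ep]]]] := path_lastP p.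
  rewrite (bigD1 v) //= /aug basis_coef eqxx scale1r !big1 ?addr0 // => [b _|w ne].
    by rewrite der_idem mulr0.
  rewrite basis_coef -(inj_eq val_inj) /= xpair_eqE eqxx andbT eq_sym.
  by rewrite (negbTE ne) scale0r.
rewrite big1 ?add0r => [|v _]; last first.
  have [r] := pcatP (e : ptgt q = psrc (parr a)); rewrite ep => -[<-] vp.
  rewrite /aug basis_coef -(inj_eq val_inj) /= vp xpair_eqE andbC.
  by rewrite /parrows /= cats1; case: (_.2) => [|? ?]; rewrite /= scale0r.
rewrite (bigD1 a) //= (der_cat _ ep) eqxx big1 ?addr0 => [|b ne].
  by have [p'] := parr_mul e; rewrite ep => -[->].
by rewrite (der_cat _ ep) (negbTE ne) mulr0.
Qed.

(** A Leibniz rule of Fox type: the last arrow of a product comes from [x], except for the constant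
    part of [x], which lets the last arrow of [y] through. *)
Lemma der_mul a x y :
  der a (x * y) = \sum_v aug v x *: der a (idem v * y) + der a x * y.
Proof.
rewrite {1}(pa_decomp x) mulrDl derD; congr (_ + _).
  rewrite mulr_suml der_sum; apply: eq_bigr => v _.
  by rewrite -pa_scaleAl derZ.
rewrite mulr_suml der_sum (bigD1 a) //= -mulrA der_arr eqxx mulrA idem_der.
rewrite big1 ?addr0 // => b ne.
by rewrite -mulrA der_arr eq_sym (negbTE ne).
Qed.

Lemma der_mul_idem a x v : der a (x * idem v) = der a x * idem v.
Proof.
rewrite der_mul big1 ?add0r // => w _; rewrite idem_idem.
by case: ifP; rewrite ?der_idem ?der0 scaler0.
Qed.

Lemma aug_Midem v w x : aug w (x * idem v) = if w == v then aug w x else 0.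
Proof.
rewrite {1 2}[x]pa_basisE mulr_suml /aug !coef_sum.
have -> : (if w == v then \sum_(p <- msupp x) (x@_p *: basis p)@_(ptriv w) else 0) =
    \sum_(p <- msupp x) if w == v then (x@_p *: basis p)@_(ptriv w) else 0.
  by case: ifP => // _; rewrite big1.
apply: eq_bigr => p _; rewrite -pa_scaleAl Midem [LHS]coefZ.
rewrite [X in _ = if _ then X else _]coefZ basis_coef.
case: (p =P ptriv w) => [->|ne]; last first.
  by rewrite !mulr0 if_same; case: ifP; rewrite ?basis_coef ?coef0 ?(introF eqP ne) mulr0.
rewrite [v == _]eq_sym; case: ifP; rewrite ?coef0 ?mulr0 // basis_coef.
by rewrite eqxx.
Qed.

Lemma der_coef a x p q : pcat (parr a) q = Some p -> (der a x)@_q = x@_p.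
Proof.
move=> ep; rewrite pa_lin_coef [x in RHS]pa_basisE coef_sum.
apply: eq_bigr => r _; rewrite coefZ basis_coef; congr (_ * _).
have [[v ->]|[b [s [e er]]]] := path_lastP r.
  rewrite dlast_triv coef0 -(inj_eq val_inj) /=.
  have e1 : ptgt q = psrc (parr a) by move: ep; rewrite /pcat; case: eqP.
  have [p'] := pcatP e1; rewrite ep => -[<-] ->.
  by rewrite xpair_eqE andbC /parrows /= cats1; case: (_.2).
rewrite (dlast_cat _ er).
have e1 : ptgt q = psrc (parr a) by move: ep; rewrite /pcat; case: eqP.
have e2 : ptgt s = psrc (parr b) by move: er; rewrite /pcat; case: eqP.
have [p' + vp] := pcatP e1; rewrite ep => -[ep']; subst p'.
have [r' + vr] := pcatP e2; rewrite er => -[er']; subst r'.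
rewrite -(inj_eq val_inj) /= vp vr xpair_eqE /parrows /= !cats1 eqseq_rcons.
rewrite eq_sym; case: eqP => _; last by rewrite !andbF coef0.
by rewrite andbT basis_coef -(inj_eq val_inj) /= -xpair_eqE -!surjective_pairing.
Qed.

(** A coinduction principle: the coefficient of a path is the constant term left after dividing by
    its arrows one after the other, so a property stable under division that kills constant terms
    kills every coefficient. *)
Lemma pa_zeroP (P : kQ -> Prop) :
  (forall x, P x -> forall v, aug v x = 0) ->
  (forall x a, P x -> P (der a x)) -> forall x, P x -> x = 0.
Proof.
move=> P0 PS x Px; apply: pa_eqP => p; rewrite coef0.
elim: {p}(plen p) {-2}p (erefl (plen p)) x Px => [|n IH] p.
  have [[v ->] _ x Px|[a [q [e ep]]]] := path_lastP p; first exact: P0.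
  have [r] := pcatP (e : ptgt q = psrc (parr a)); rewrite ep => -[<-] vp.
  by rewrite /plen {1}/parrows vp /= size_cat addn1.
have [[v ->]|[a [q [e ep]]]] := path_lastP p => // np x Px.
rewrite -(der_coef _ ep); apply: IH; last exact: PS.
have [r] := pcatP (e : ptgt q = psrc (parr a)); rewrite ep => -[er] vp.
by move: np; rewrite /plen {1}/parrows er vp /= size_cat addn1 => -[].
Qed.

Lemma msuppP x p : reflect (x@_p <> 0) (p \in msupp x).
Proof. by rewrite -mcoeff_neq0; apply: (iffP idP) => /eqP. Qed.

Lemma homog_basis p : pa_homog (plen p) (basis p).
Proof.
move=> q /msuppP; rewrite basis_coef; case: (p =P q) => [-> //|_] /=.
by rewrite mulr0n.
Qed.

Lemma homog_idem v : pa_homog 0 (idem v).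
Proof. exact: (@homog_basis (ptriv v)). Qed.

Lemma homog_arr a : pa_homog 1 (arr a).
Proof. exact: (@homog_basis (parr a)). Qed.

Lemma homogD n x y : pa_homog n x -> pa_homog n y -> pa_homog n (x + y).
Proof.
move=> hx hy p /msuppP; rewrite coefD => ne.
have [/hx //|nx] := boolP (p \in msupp x).
have [/hy //|ny] := boolP (p \in msupp y).
by rewrite !mcoeff_outdom ?addr0 in ne.
Qed.

Lemma homogZ n c x : pa_homog n x -> pa_homog n (c *: x).
Proof.
move=> hx p /msuppP; rewrite coefZ => ne; apply: hx; apply/msuppP => e.
by rewrite e mulr0 in ne.
Qed.

Lemma homog0 n : pa_homog n (0 : kQ).
Proof. by move=> p /msuppP; rewrite coef0. Qed.

Lemma homog_sum n (I : Type) (r : seq I) (F : I -> kQ) :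
  (forall i, pa_homog n (F i)) -> pa_homog n (\sum_(i <- r) F i).
Proof. by move=> hF; apply: big_ind => //; [exact: homog0 | exact: homogD]. Qed.

Lemma homog_scal c : pa_homog 0 (kscal c).
Proof. by rewrite kscal.unlock; apply/homogZ/homog_sum => v; apply: homog_idem. Qed.

Definition hpart n : kQ -> kQ :=
  pa_lin (fun p => if plen p == n then basis p else 0).

Lemma homog_hpart n x : pa_homog n (hpart n x).
Proof.
rewrite /hpart pa_lin.unlock; apply: homog_sum => p; apply: homogZ.
case: eqP => [<-|_]; last exact: homog0.
exact: homog_basis.
Qed.

Lemma sum_hpart x : exists L, x = \sum_(n < L) hpart n x.
Proof.
exists (\max_(p <- msupp x) (plen p)).+1; rewrite /hpart pa_lin.unlock exchange_big /=.
rewrite {1}[x]pa_basisE; apply: eq_big_seq => p px.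
have lt : (plen p < (\max_(p <- msupp x) (plen p)).+1)%N.
  by rewrite ltnS (big_rem p px) /= leq_maxl.
rewrite (bigD1 (Ordinal lt)) //= eqxx big1 ?addr0 // => i ne.
by rewrite eq_sym (_ : (_ == _) = false) ?scaler0 //; apply/negbTE.
Qed.

Lemma hpart_homog m n x : pa_homog m x -> hpart n x = if n == m then x else 0.
Proof.
move=> hx; rewrite /hpart pa_lin.unlock.
have e p : p \in msupp x -> x@_p *: (if plen p == n then basis p else 0) =
    if n == m then x@_p *: basis p else 0.
  by move=> /hx ->; rewrite eq_sym; case: ifP; rewrite ?scaler0.
rewrite (eq_big_seq _ e); case: ifP => _; last by rewrite big1.
by rewrite -pa_basisE.
Qed.

Lemma mul_kscal c x : kscal c * x = c *: x.
Proof. by rewrite kscal.unlock -pa_scaleAl mul1r. Qed.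

Lemma kscalM c c' : kscal (c * c') = kscal c * kscal c'.
Proof. by rewrite mul_kscal kscal.unlock scalerA. Qed.

Lemma kscalD c c' : kscal (c + c') = kscal c + kscal c'.
Proof. by rewrite kscal.unlock scalerDl. Qed.

Lemma kscalN c : kscal (- c) = - kscal c.
Proof. by rewrite kscal.unlock scaleNr. Qed.

Lemma kscal1 : kscal 1 = 1.
Proof. by rewrite kscal.unlock scale1r. Qed.

Lemma mul_kscalr c x : x * kscal c = c *: x.
Proof. by rewrite kscal.unlock -pa_scaleAr mulr1. Qed.

End PathAlgebraDerivations.

(** * Homogeneous components and tails *)

Lemma addr_idem_eq0 (V : zmodType) (x : V) : x = x + x -> x = 0.
Proof. by move=> e; apply: (addrI x); rewrite addr0 -e. Qed.

Definition eventually (P : int -> Prop) := exists N : int, forall n, N <= n -> P n.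

Lemma eventually_and P R :
  eventually P -> eventually R -> eventually (fun n => P n /\ R n).
Proof.
move=> [N HN] [N' HN']; exists (`|N| + `|N'|) => n le.
split; [apply: HN|apply: HN']; apply: le_trans le.
  by rewrite (le_trans (ler_norm _)) // lerDl.
by rewrite (le_trans (ler_norm _)) // lerDr.
Qed.

Lemma eventually_imp (P R : int -> Prop) :
  (forall n, P n -> R n) -> eventually P -> eventually R.
Proof. by move=> PR [N HN]; exists N => n /HN /PR. Qed.

Lemma eventually_all (T : finType) (P : T -> int -> Prop) :
  (forall t, eventually (P t)) -> eventually (fun n => forall t, P t n).
Proof.
move=> /choice[f Hf]; exists (\sum_t `|f t|) => n le t; apply: Hf.
apply: le_trans le; rewrite (bigD1 t) //=.
by rewrite (le_trans (ler_norm _)) // lerDl sumr_ge0.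
Qed.

Lemma sum_support (V : zmodType) (s t : seq int) (c : int -> V) :
  uniq s -> uniq t -> {subset s <= t} -> (forall d, d \notin s -> c d = 0) ->
  \sum_(d <- s) c d = \sum_(d <- t) c d.
Proof.
move=> us ut st c0; rewrite [RHS](bigID (mem s)) /= [X in _ + X]big1 ?addr0 //.
rewrite -[RHS]big_filter; apply/perm_big/uniq_perm => //; first exact: filter_uniq.
by move=> d; rewrite mem_filter /=; case: (boolP (d \in s)) => //= /st ->.
Qed.

Section GradedComponents.
Variables (k : fieldType) (Q : quiver).
Local Notation kQ := (path_algebra k Q).
Local Notation "c ** x" := (kscal Q c *: x) (at level 40, left associativity).
Implicit Types (M N : grmod k Q) (d n : int).

Lemma kscaleA (V : lmodType kQ) c (a : kQ) (x : V) : (c *: a) *: x = c ** (a *: x).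
Proof. by rewrite scalerA mul_kscal. Qed.

Lemma gdegN M d (x : M) : gdeg d x -> gdeg d (- x).
Proof. by move=> dx; rewrite -sub0r; apply: gdegB => //; apply: gdeg0. Qed.

Lemma gdegD M d (x y : M) : gdeg d x -> gdeg d y -> gdeg d (x + y).
Proof. by move=> dx dy; rewrite -(opprK y); apply/gdegB/gdegN. Qed.

Lemma gdeg_sum M d (I : Type) (r : seq I) (F : I -> M) :
  (forall i, gdeg d (F i)) -> gdeg d (\sum_(i <- r) F i).
Proof. by move=> dF; apply: big_ind => //; [exact: gdeg0 | exact: gdegD]. Qed.

Lemma gdegM0 M d (a : kQ) (x : M) : pa_homog 0 a -> gdeg d x -> gdeg d (a *: x).
Proof. by move=> ha dx; rewrite -[d]add0r; apply: gdegM. Qed.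

Lemma homog_decomp M (x : M) : exists c : int -> M, (forall d, gdeg d (c d)) /\
  exists s, [/\ uniq s, forall d, d \notin s -> c d = 0 & x = \sum_(d <- s) c d].
Proof.
have [s [c [dc ->]]] := gdeg_span x.
(* The list [s] may repeat degrees; the multiplicities are absorbed into the components, which also
   makes them vanish off [s]. *)
exists (fun d => c d *+ count_mem d s); split.
  move=> d; elim: (count_mem d s) => [|n IH]; first by rewrite mulr0n; apply: gdeg0.
  by rewrite mulrS; apply: gdegD.
exists (undup s); split; first exact: undup_uniq.
  by move=> d; rewrite mem_undup => /count_memPn ->.
rewrite big_undup_iterop_count; apply: eq_bigr => d _.
by [].
Qed.

Definition hcomp M d (x : M) : M := projT1 (cid (homog_decomp x)) d.

Lemma hcomp_deg M d (x : M) : gdeg d (hcomp d x).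
Proof. by rewrite /hcomp; case: cid => c []. Qed.

Lemma hcomp_sum M (x : M) : exists s,
  [/\ uniq s, forall d, d \notin s -> hcomp d x = 0 & x = \sum_(d <- s) hcomp d x].
Proof. by rewrite /hcomp; case: cid => c []. Qed.

(** [gdeg_indep] applied to the difference of two decompositions on the union of their supports;
    this frees [hcomp] from the choice made in its definition. *)
Lemma hcomp_uniq M (x : M) (s : seq int) (c : int -> M) :
  uniq s -> (forall d, gdeg d (c d)) -> (forall d, d \notin s -> c d = 0) ->
  x = \sum_(d <- s) c d -> forall d, hcomp d x = c d.
Proof.
move=> us dc c0 ex; have [t [ut h0 et]] := hcomp_sum x.
set u := undup (s ++ t).
have su : {subset s <= u} by move=> d; rewrite mem_undup mem_cat => ->.
have tu : {subset t <= u} by move=> d; rewrite mem_undup mem_cat orbC => ->.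
have uu : uniq u by apply: undup_uniq.
have := @gdeg_indep _ _ M u (fun d => hcomp d x - c d) uu.
move=> /(_ (fun d => gdegB (hcomp_deg _ _) (dc d))).
rewrite sumrB -(sum_support ut uu) // -(sum_support us uu) // -et -ex subrr.
move=> /(_ erefl) e d; case: (boolP (d \in u)) => [/e /eqP|du].
  by rewrite subr_eq0 => /eqP.
by rewrite h0 ?c0 //; apply: contra du; [apply: su|apply: tu].
Qed.

(* The degree-shift lemma behind every compatibility with homogeneous
   components; [f] needs to be additive only on [P], which is used for maps
   that are morphisms in high degrees only. *)
Lemma hcomp_map M N (P : M -> Prop) (f : M -> N) (j : int) :
  P 0 -> (forall x y, P x -> P y -> P (x + y)) ->
  (forall d x, P x -> P (hcomp d x)) ->
  (forall x y, P x -> P y -> f (x + y) = f x + f y) ->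
  (forall d x, gdeg d x -> P x -> gdeg (j + d) (f x)) ->
  forall d x, P x -> hcomp (j + d) (f x) = f (hcomp d x).
Proof.
move=> P0 PD Ph fD fdeg d x Px; have [s [us h0 ex]] := hcomp_sum x.
have f0 : f 0 = 0 by apply: addr_idem_eq0; rewrite -fD // addr0.
rewrite (@hcomp_uniq _ (f x) [seq j + e | e <- s] (fun e => f (hcomp (e - j) x))).
- by rewrite [j + d]addrC addrK.
- by rewrite map_inj_uniq //; apply: addrI.
- by move=> e; rewrite -{1}[e](subrK j) addrC; apply/fdeg/Ph => //; apply: hcomp_deg.
- move=> e es; rewrite h0 //; apply: contra es => es; apply/mapP; exists (e - j) => //.
  by rewrite addrC subrK.
rewrite big_map {1}ex; elim: (s) => [|e r IH]; first by rewrite !big_nil.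
rewrite !big_cons fD ?IH //; first by rewrite [j + e]addrC addrK.
  exact: Ph.
by apply: big_ind => // e' _; apply: Ph.
Qed.

Lemma hcompD M d (x y : M) : hcomp d (x + y) = hcomp d x + hcomp d y.
Proof.
have [s [us hs es]] := hcomp_sum x; have [t [ut ht et]] := hcomp_sum y.
set u := undup (s ++ t).
have su : {subset s <= u} by move=> e; rewrite mem_undup mem_cat => ->.
have tu : {subset t <= u} by move=> e; rewrite mem_undup mem_cat orbC => ->.
have uu : uniq u by apply: undup_uniq.
apply: (@hcomp_uniq _ _ u (fun e => hcomp e x + hcomp e y)) => //.
- by move=> e; apply: gdegD; apply: hcomp_deg.
- by move=> e eu; rewrite hs ?ht ?addr0 //; apply: contra eu; [apply: tu|apply: su].
by rewrite big_split /= -(sum_support us uu) // -(sum_support ut uu) // -es -et.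
Qed.

Lemma hcomp0 M d : hcomp d (0 : M) = 0.
Proof. by apply: addr_idem_eq0; rewrite -hcompD addr0. Qed.

Lemma hcompN M d (x : M) : hcomp d (- x) = - hcomp d x.
Proof. by apply/eqP; rewrite -addr_eq0 -hcompD addNr hcomp0. Qed.

Lemma hcomp_bigsum M d (I : Type) (r : seq I) (F : I -> M) :
  hcomp d (\sum_(i <- r) F i) = \sum_(i <- r) hcomp d (F i).
Proof. exact: (big_morph _ (hcompD d) (hcomp0 M d)). Qed.

Lemma hcompM M (n : nat) d (a : kQ) (x : M) : pa_homog n a ->
  hcomp (n%:Z + d) (a *: x) = a *: hcomp d x.
Proof.
move=> ha; apply: (@hcomp_map M M (fun=> True) (fun x => a *: x)) => //.
  by move=> y z _ _; rewrite scalerDr.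
by move=> e y dy _; apply: gdegM.
Qed.

Lemma hcompM0 M d (a : kQ) (x : M) : pa_homog 0 a -> hcomp d (a *: x) = a *: hcomp d x.
Proof. by move=> ha; rewrite -{1}[d]add0r (hcompM _ _ ha). Qed.

Lemma hcomp_hom M N (f : grhom M N) d x : hcomp d (f x) = f (hcomp d x).
Proof.
rewrite -{1}[d]add0r; apply: (@hcomp_map M N (fun=> True) f 0) => //.
  by move=> y z _ _; rewrite linearD.
by move=> e y dy _; rewrite add0r; apply: ghom_deg.
Qed.

Lemma hcomp_homog M d e (x : M) : gdeg d x -> hcomp e x = if e == d then x else 0.
Proof.
move=> dx; apply: (@hcomp_uniq _ _ [:: d] (fun e => if e == d then x else 0)) => //.
- by move=> e'; case: eqP => [->|_] //; apply: gdeg0.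
- by move=> e'; rewrite inE => /negbTE ->.
by rewrite big_seq1 eqxx.
Qed.

Lemma hcomp_id M d (x : M) : gdeg d x -> hcomp d x = x.
Proof. by move=> /(hcomp_homog d) ->; rewrite eqxx. Qed.

Lemma hcomp_eq0 M (x : M) : (forall d, hcomp d x = 0) -> x = 0.
Proof. by move=> h0; have [s [_ _ ->]] := hcomp_sum x; rewrite big1. Qed.

(** The absolute value bounds the support at both ends: the upper end gives vanishing in high
    degrees, the lower end serves in [hcomp_low]. *)
Lemma hcomp_bounded M (x : M) : exists N : int, forall d, N <= `|d| -> hcomp d x = 0.
Proof.
have [s [_ h0 _]] := hcomp_sum x; exists (\sum_(d <- s) `|d| + 1) => d le; apply: h0.
apply: contraL le => ds; rewrite -ltNge (big_rem d ds) /= -addrA ltrDl.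
by rewrite ltr_wpDl // sumr_ge0.
Qed.

Lemma hcomp_eventually0 M (x : M) : eventually (fun d => hcomp d x = 0).
Proof.
have [N HN] := hcomp_bounded x; exists N => d le; apply: HN.
exact: le_trans le (ler_norm d).
Qed.

(** Membership in the truncation [M_{>=n}]. A predicate on [M] lets maps on different tails be
    compared without changing their domain. *)
Definition tail M n (x : M) := forall d, d < n -> hcomp d x = 0.

Lemma tail0 M n : tail n (0 : M). Proof. by move=> d _; apply: hcomp0. Qed.

Lemma tailD M n (x y : M) : tail n x -> tail n y -> tail n (x + y).
Proof. by move=> tx ty d lt; rewrite hcompD tx // ty // addr0. Qed.

Lemma tailN M n (x : M) : tail n x -> tail n (- x).
Proof. by move=> tx d lt; rewrite hcompN tx // oppr0. Qed.

Lemma tail_sum M n (I : Type) (r : seq I) (F : I -> M) :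
  (forall i, tail n (F i)) -> tail n (\sum_(i <- r) F i).
Proof. by move=> tF; apply: big_ind => //; [exact: tail0 | exact: tailD]. Qed.

Lemma tailMh M n (m : nat) (a : kQ) (x : M) : pa_homog m a -> tail n x -> tail (m%:Z + n) (a *: x).
Proof.
move=> ha tx d lt; rewrite -[d](subrK m%:Z) addrC (hcompM _ _ ha) tx ?scaler0 //.
by rewrite ltrBlDl.
Qed.

Lemma tail_le M m n (x : M) : m <= n -> tail n x -> tail m x.
Proof. by move=> le tx d lt; apply: tx; apply: lt_le_trans lt le. Qed.

(** Path lengths are nonnegative, so no homogeneous part of [a] lowers degrees. *)
Lemma tailM M n (a : kQ) (x : M) : tail n x -> tail n (a *: x).
Proof.
move=> tx; have [L ->] := sum_hpart a; rewrite scaler_suml; apply: tail_sum => i.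
apply: tail_le (tailMh (@homog_hpart _ _ i a) tx).
by rewrite lerDr.
Qed.

Lemma tail_deg M n d (x : M) : gdeg d x -> n <= d -> tail n x.
Proof.
move=> dx le e lt; rewrite (hcomp_homog _ dx); case: eqP => // ed.
by rewrite ed ltNge le in lt.
Qed.

Lemma tail_hcomp M n d (x : M) : tail n x -> tail n (hcomp d x).
Proof.
move=> tx e lt; rewrite (hcomp_homog _ (hcomp_deg d x)).
by case: eqP => // <-; apply: tx.
Qed.

Lemma tail_ind M n (P : M -> Prop) : P 0 -> (forall x y, P x -> P y -> P (x + y)) ->
  (forall d x, n <= d -> gdeg d x -> P x) -> forall x, tail n x -> P x.
Proof.
move=> P0 PD Ph x tx; have [s [_ _ ->]] := hcomp_sum x; apply: big_ind => // d _.
have [le|lt] := leP n d; first exact: Ph le (hcomp_deg d x).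
by rewrite tx.
Qed.

Lemma tail_hom M N (f : grhom M N) n x : tail n x -> tail n (f x).
Proof. by move=> tx d lt; rewrite hcomp_hom tx // linear0. Qed.

Lemma tail_comp_eq0 M n (x : M) : tail n x -> (forall d, n <= d -> hcomp d x = 0) -> x = 0.
Proof. by move=> tx h; apply: hcomp_eq0 => d; case: (leP n d) => [/h|/tx]. Qed.

End GradedComponents.

(** * Tails of finitely presented modules are free *)

Section Growth.
Variables (k : fieldType) (Q : quiver).
Local Notation kQ := (path_algebra k Q).
Local Notation "c ** x" := (kscal Q c *: x) (at level 40, left associativity).
Local Notation arr a := (arr k a).
Local Notation idem v := (idem k v).
Implicit Types (M N : grmod k Q) (d n : int).

Definition finitely_generated (V : lmodType kQ) :=
  exists r (g : 'I_r -> V), forall x, exists c : 'I_r -> kQ, x = \sum_i c i *: g i.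

Lemma fp_fg (V : lmodType kQ) : finitely_presented V -> finitely_generated V.
Proof.
move=> [r [phi [phiS _]]]; exists r, (fun i => phi (delta_mx 0 i)) => x.
have [u <-] := phiS x; exists (fun i => u 0 i).
by rewrite {1}[u]row_sum_delta linear_sum; apply: eq_bigr => i _; rewrite linearZ.
Qed.

Lemma row_sum_entry r (I : Type) (s : seq I) (F : I -> 'rV[kQ]_r) (j : 'I_r) :
  (\sum_(i <- s) F i) 0 j = \sum_(i <- s) F i 0 j.
Proof.
by elim/big_rec2: _ => [|i x y _ <-]; rewrite mxE.
Qed.

(** Splitting each coefficient of a generator by [pa_decomp], the constant terms contribute only in
    the degrees of the generators, which are all exceeded; what remains is a sum of multiples of
    arrows. *)
Lemma fg_grow M : finitely_generated M -> eventually (fun n =>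
  forall x : M, gdeg (1 + n) x -> exists z : arrow Q -> M,
    [/\ forall a, gdeg n (z a), forall a, idem (src a) *: z a = z a &
        x = \sum_a arr a *: z a]).
Proof.
move=> [r [g gS]].
have [N HN] := eventually_all (fun i => hcomp_eventually0 (g i)).
exists N => n le x dx; have [c ex] := gS x.
exists (fun a => hcomp n (\sum_i der a (c i) *: g i)); split.
- by move=> a; apply: hcomp_deg.
- move=> a; rewrite -hcompM0; last exact: homog_idem.
  by rewrite scaler_sumr; congr hcomp; apply: eq_bigr => i _; rewrite scalerA idem_der.
rewrite -[LHS](hcomp_id dx) {1}ex hcomp_bigsum.
under [RHS]eq_bigr => a _.
  rewrite -(hcompM _ _ (@homog_arr k Q a)) scaler_sumr hcomp_bigsum.
  under eq_bigr => i _ do rewrite scalerA.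
  over.
rewrite exchange_big; apply: eq_bigr => i _ /=.
rewrite {1}[c i]pa_decomp scalerDl hcompD !scaler_suml !hcomp_bigsum.
rewrite big1 ?add0r // => v _.
rewrite hcompM0; last exact/homogZ/homog_idem.
by rewrite HN ?scaler0 // (le_trans le) // lerDr.
Qed.

(* Left division by [b] of a relation [sum_a a y_a = sum_i c_i rel_i] shows that
   [y_b] is, modulo relations, a k-combination of the finitely many left
   divisions of the [e_v rel_i], which have bounded degree. *)
Lemma fp_arr_free M : finitely_presented M -> eventually (fun n =>
  forall z : arrow Q -> M, (forall a, gdeg n (z a)) ->
    (forall a, idem (src a) *: z a = z a) ->
    \sum_a arr a *: z a = 0 -> forall a, z a = 0).
Proof.
move=> [r [phi [phiS [q [rel relP]]]]].
pose D b v i : 'rV[kQ]_r := \row_j der b (idem v * rel i 0 j).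
have [N HN] : eventually (fun n => forall b v i, hcomp n (phi (D b v i)) = 0).
  by do 3!apply: eventually_all => ?; apply: hcomp_eventually0.
exists N => n le z dz iz z0 b.
have [y Hy] := choice (fun a => phiS (z a)).
(* With this correction the lift still maps to [z a], and dividing [arr b *: y' b] by [b] returns
   [y' b] exactly. *)
pose y' a := idem (src a) *: y a.
have phiy a : phi (y' a) = z a by rewrite linearZ /= Hy iz.
have /relP[c ec] : phi (\sum_a arr a *: y' a) = 0.
  by rewrite linear_sum -[RHS]z0; apply: eq_bigr => a _; rewrite linearZ /= phiy.
have ey : y' b = \sum_i \sum_v (aug v (c i)) ** D b v i + \sum_i der b (c i) *: rel i.
  apply/rowP => j; have /(congr1 (der b)) := congr1 (fun u : 'rV_r => u 0 j) ec.
  rewrite /= !row_sum_entry !der_sum [X in _ -> _ = X]mxE !row_sum_entry.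
  rewrite (bigD1 b) //= big1 ?addr0 => [|a ne]; last first.
    by rewrite !mxE der_arr eq_sym (negbTE ne).
  rewrite !mxE der_arr eqxx mulrA idem_idem eqxx => ->.
  rewrite -big_split; apply: eq_bigr => i _ /=.
  rewrite mxE der_mul [in RHS]mxE row_sum_entry; congr (_ + _).
  by apply: eq_bigr => v _; rewrite !mxE mul_kscal.
have phir : phi (\sum_i der b (c i) *: rel i) = 0 by apply/relP; exists (fun i => der b (c i)).
rewrite -(hcomp_id (dz b)) -phiy ey linearD /= phir addr0 linear_sum hcomp_bigsum.
rewrite big1 // => i _; rewrite linear_sum hcomp_bigsum big1 // => v _.
by rewrite linearZ /= hcompM0 ?HN ?scaler0 //; apply: homog_scal.
Qed.

Lemma fp_arr_free_tail M : finitely_presented M -> eventually (fun n =>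
  forall z : arrow Q -> M, (forall a, tail n (z a)) ->
    (forall a, idem (src a) *: z a = z a) ->
    \sum_a arr a *: z a = 0 -> forall a, z a = 0).
Proof.
move=> /fp_arr_free[N HN]; exists N => n le z tz iz z0 b.
apply: (tail_comp_eq0 (tz b)) => d led.
apply: (HN d (le_trans le led) (fun a => hcomp d (z a))).
- by move=> a; apply: hcomp_deg.
- by move=> a; rewrite -hcompM0 ?iz //; apply: homog_idem.
under eq_bigr => a _ do rewrite -(hcompM _ _ (@homog_arr k Q a)).
by rewrite -hcomp_bigsum z0 hcomp0.
Qed.

(* [0] when the arrows listed in [t] do not compose. *)
Definition short_path L (t : vertex Q * L.-bseq (arrow Q)) : kQ :=
  if insub (t.1, val t.2) is Some p then pa_basis k p else 0.

(** Truncation at length [L]. Bounded sequences of arrows form a finite type, so the short part is a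
    combination over an index set independent of [x]; this is the source of
    finite-dimensionality. *)
Lemma short_path_decomp L (x : kQ) : exists (c : vertex Q * L.-bseq (arrow Q) -> k) y,
  x = \sum_t c t *: short_path t + y /\ forall p, p \in msupp y -> (L < plen p)%N.
Proof.
pose c (t : vertex Q * L.-bseq (arrow Q)) : k :=
  if insub (t.1, val t.2) is Some p then x@_p else 0.
exists c, (x - \sum_t c t *: short_path t); split; first by rewrite addrC subrK.
move=> p /msuppP ne; rewrite ltnNge; apply/negP => le; apply: ne.
pose t0 : vertex Q * L.-bseq (arrow Q) := (psrc p, Bseq le).
have et0 : (t0.1, val t0.2) = val p by rewrite /= -surjective_pairing.
rewrite coefB coef_sum (bigD1 t0) //= [X in _ - (X + _)]coefZ.
rewrite /c /short_path et0 valK basis_coef eqxx mulr1 big1 ?addr0 ?subrr // => t ne.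
rewrite coefZ; case: insubP => [q _ eq|_]; last by rewrite mul0r.
rewrite basis_coef -(inj_eq val_inj) eq -et0; case: eqP => [[e1 e2]|_]; last by rewrite mulr0.
by case/eqP: ne; rewrite [t]surjective_pairing e1; congr (_, _); apply: val_inj.
Qed.

(** A path of length [l] carries the component of degree [n - l] into degree [n]. *)
Lemma hcomp_long_path M n L (g : M) (y : kQ) :
  (forall l : nat, (L < l)%N -> hcomp (n - l%:Z) g = 0) ->
  (forall p, p \in msupp y -> (L < plen p)%N) -> hcomp n (y *: g) = 0.
Proof.
move=> h0 hy; rewrite [y]pa_basisE scaler_suml hcomp_bigsum big1_seq // => p /= py.
rewrite kscaleA hcompM0; last exact: homog_scal.
by rewrite -[n](subrK (plen p)%:Z) addrC (hcompM _ _ (@homog_basis k Q p)) h0 ?hy // !scaler0.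
Qed.

(** The support of [g] is bounded below, so long paths push [g] beyond degree [n]. Any larger [L] is
    allowed so that a maximum serves several generators, and all [d <= n] are treated at once for
    the use in [tail_quot_fdim]. *)
Lemma hcomp_low M (g : M) n : exists L0, forall L, (L0 <= L)%N -> forall l : nat, (L < l)%N ->
  forall d, d <= n -> hcomp (d - l%:Z) g = 0.
Proof.
have [N HN] := hcomp_bounded g; exists (`|N|%N + `|n|%N)%N => L le l lt d dn.
by apply: HN; lia.
Qed.

End Growth.

(** * Bases of homogeneous components and freeness of tails *)

Section FreeTails.
Variables (k : fieldType) (Q : quiver).
Local Notation kQ := (path_algebra k Q).
Local Notation "c ** x" := (kscal Q c *: x) (at level 40, left associativity).
Local Notation arr a := (arr k a).
Local Notation idem v := (idem k v).
Implicit Types (M N : grmod k Q) (d n : int).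

Lemma sum_idem_scale (V : lmodType kQ) (x : V) : \sum_v idem v *: x = x.
Proof. by rewrite -scaler_suml sum_idem scale1r. Qed.

Lemma fg_degree_span M n : finitely_generated M ->
  exists (T : finType) (f : T -> M) (v : T -> vertex Q),
    [/\ forall t, gdeg n (f t), forall t, idem (v t) *: f t = f t &
      forall x, gdeg n x -> exists c : T -> k, x = \sum_t c t ** f t].
Proof.
move=> [r [g gS]].
have [L0 HL0] := choice (fun i => hcomp_low (g i) n).
pose L := \max_i L0 i.
have HL i (l : nat) : (L < l)%N -> hcomp (n - l%:Z) (g i) = 0.
  by move=> lt; apply: (HL0 i L) => //; apply: leq_bigmax.
pose T := ('I_r * (vertex Q * L.-bseq (arrow Q)) * vertex Q)%type.
(* Short paths times generators span degree [n], since longer paths overshoot it. Each vector is cut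
   by every idempotent so that it sits at one vertex; the pieces sum back to it. *)
exists T, (fun t => idem t.2 *: hcomp n (short_path k t.1.2 *: g t.1.1)), snd; split.
- by move=> t; apply: gdegM0 (hcomp_deg _ _); apply: homog_idem.
- by move=> t; rewrite scalerA idem_idem eqxx.
move=> x dx; have [c ex] := gS x.
have [cc Hcc] := choice (fun i => short_path_decomp L (c i)).
exists (fun t : T => cc t.1.1 t.1.2).
rewrite -[LHS](hcomp_id dx) ex hcomp_bigsum.
rewrite -(pair_bigA _ (fun t v => cc t.1 t.2 ** (idem v *: hcomp n (short_path k t.2 *: g t.1)))) /=.
rewrite -(pair_bigA _ (fun i t => \sum_v cc i t ** (idem v *: hcomp n (short_path k t *: g i)))) /=.
apply: eq_bigr => i _; have [y [-> hy]] := Hcc i.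
rewrite scalerDl hcompD (@hcomp_long_path _ _ _ _ L _ y) ?addr0 //; last by move=> l; apply: HL.
rewrite scaler_suml hcomp_bigsum; apply: eq_bigr => t _.
rewrite -scaler_sumr sum_idem_scale kscaleA hcompM0 //; exact: homog_scal.
Qed.

Definition degree_span M n r (b : 'I_r -> M) (v : 'I_r -> vertex Q) : Prop :=
  [/\ forall i, gdeg n (b i), forall i, idem (v i) *: b i = b i &
    forall x, gdeg n x -> exists c : 'I_r -> k, x = \sum_i c i ** b i].

(** A spanning family of least cardinality, among those whose vectors each sit at a vertex, is
    independent. Deleting a vector keeps the others at their vertices. *)
Lemma degree_basis M n : finitely_generated M -> exists r (b : 'I_r -> M) v,
  degree_span n b v /\ forall c : 'I_r -> k, \sum_i c i ** b i = 0 -> forall i, c i = 0.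
Proof.
move=> fgM.
have ex : exists r, `[< exists (b : 'I_r -> M) v, degree_span n b v >].
  have [T [f [v [fd fv fS]]]] := fg_degree_span n fgM.
  exists #|T|; apply/asboolP; exists (fun i => f (enum_val i)), (fun i => v (enum_val i)).
  split=> // x /fS[c ->]; exists (fun i => c (enum_val i)).
  by rewrite (reindex (fun i : 'I_#|T| => enum_val i)) //; apply/onW_bij/enum_val_bij.
case: (ex_minnP ex) => r /asboolP[b [v sp]] min; exists r, b, v; split=> // c c0 i.
case: r b v sp min c c0 i => [|r] b v sp min c c0 i; first by case: i.
apply/eqP/negPn/negP => ne; have := min r.
rewrite ltnn => /(_ _)/negP; apply => //; apply/asboolP.
exists (fun j => b (lift i j)), (fun j => v (lift i j)); case: sp => bd bv bS.
(* The relation is solved for [b i], which is possible as [c i] is invertible, and the result is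
   substituted into the expansion of [x]. *)
split=> // x /bS[e ->]; exists (fun j => e (lift i j) - e i / c i * c (lift i j)).
have bi : b i = - \sum_j (c (lift i j) / c i) ** b (lift i j).
  apply/eqP; rewrite -addr_eq0; apply/eqP.
  have := congr1 (fun x => (c i)^-1 ** x) c0; rewrite scaler0 => e0; rewrite -[RHS]e0.
  rewrite (bigD1_ord i) //= scalerDr scalerA -kscalM mulVf // kscal1 scale1r.
  rewrite scaler_sumr; congr (_ + _); apply: eq_bigr => j _.
  by rewrite scalerA -kscalM mulrC.
rewrite (bigD1_ord i) //= bi scalerN scaler_sumr addrC -sumrB; apply: eq_bigr => j _.
by rewrite kscalD kscalN scalerBl scalerA -kscalM mulrAC mulrA.
Qed.

(** This says that [M_{>=n}] is the direct sum of the projectives [kQ e_{v i}] on the generators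
    [b i]. As [b i] is fixed by [idem (v i)], its coefficient matters only after right
    multiplication by this idempotent. *)
Definition free_tail M n r (b : 'I_r -> M) (v : 'I_r -> vertex Q) : Prop :=
  [/\ forall i, gdeg n (b i), forall i, idem (v i) *: b i = b i,
    forall x, tail n x -> exists c : 'I_r -> kQ, x = \sum_i c i *: b i &
    forall c : 'I_r -> kQ, \sum_i c i *: b i = 0 -> forall i, c i * idem (v i) = 0].

(** A basis of degree [n] generates the tail by repeated use of [fg_grow]. For independence, a
    relation is divided by arrows: each quotient is again a relation, and its constant terms vanish
    because the basis is independent over [k]. *)
Lemma fp_free_tail M : finitely_presented M ->
  eventually (fun n => exists r (b : 'I_r -> M) v, free_tail n b v).
Proof.
move=> fpM; have fgM := fp_fg fpM.
have [N HN] := fg_grow fgM; have [N' HN'] := fp_arr_free_tail fpM.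
exists (`|N| + `|N'|) => n le.
have leN : N <= n by apply: le_trans le; rewrite (le_trans (ler_norm _)) // lerDl.
have leN' : N' <= n by apply: le_trans le; rewrite (le_trans (ler_norm _)) // lerDr.
have [r [b [v [[bd bv bS] free]]]] := degree_basis n fgM.
exists r, b, v; split=> //.
  apply: tail_ind.
  - by exists (fun=> 0); rewrite big1 // => i _; rewrite scale0r.
  - move=> x y [c ->] [c' ->]; exists (fun i => c i + c' i).
    by rewrite -big_split; apply: eq_bigr => i _; rewrite scalerDl.
  move=> d x led dx; have {led} [m em] : exists m : nat, d = m%:Z + n.
    by exists `|d - n|%N; rewrite gez0_abs ?subrK // subr_ge0.
  rewrite {}em in dx; elim: m x dx => [|m IH] x dx.
    have [c ->] : exists c : 'I_r -> k, x = \sum_i c i ** b i.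
      by apply: bS; rewrite add0r in dx.
    by exists (fun i => kscal Q (c i)).
  have dx' : gdeg (1 + (m%:Z + n)) x by rewrite addrA -PoszD add1n.
  have [|z [dz iz ->]] := HN _ _ x dx'; first by rewrite (le_trans leN) // lerDr.
  have [c Hc] := choice (fun a => IH (z a) (dz a)).
  exists (fun i => \sum_a arr a * c a i).
  under [RHS]eq_bigr => i _ do rewrite scaler_suml.
  rewrite exchange_big; apply: eq_bigr => a _ /=.
  by rewrite {1}Hc scaler_sumr; apply: eq_bigr => i _; rewrite scalerA.
move=> c c0 i.
(* The coefficients of all normalised relations form a class stable under left division, as
   [pa_zeroP] requires. Normalisation leaves only the constant term at [v j] to be checked. *)
pose P (x : kQ) := exists c : 'I_r -> kQ, [/\ forall j, c j * idem (v j) = c j,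
  \sum_j c j *: b j = 0 & exists j, x = c j].
(* The degree n part of [sum_j c j *: b j] only involves the constant terms. *)
have key c' : (forall j, c' j * idem (v j) = c' j) -> \sum_j c' j *: b j = 0 ->
    (forall j, aug (v j) (c' j) = 0) /\
    (forall a, \sum_j der a (c' j) *: b j = 0).
  move=> cv cb; pose z a := \sum_j der a (c' j) *: b j.
  have ez : \sum_j c' j *: b j = \sum_j aug (v j) (c' j) ** b j + \sum_a arr a *: z a.
    under [X in _ + X]eq_bigr => a _ do rewrite scaler_sumr.
    rewrite [X in _ + X]exchange_big -big_split; apply: eq_bigr => j _ /=.
    rewrite {1}[c' j]pa_decomp scalerDl !scaler_suml; congr (_ + _); last first.
      by apply: eq_bigr => a _; rewrite scalerA.
    rewrite (bigD1 (v j)) //= big1 ?addr0 => [|w ne]; first by rewrite kscaleA bv.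
    by rewrite -(bv j) scalerA -pa_scaleAl idem_idem (negbTE ne) scaler0 scale0r.
  have tz a : tail n (z a) by apply: tail_sum => j; apply/tailM/tail_deg.
  have iz a : idem (src a) *: z a = z a.
    by rewrite scaler_sumr; apply: eq_bigr => j _; rewrite scalerA idem_der.
  have dn : gdeg n (\sum_j aug (v j) (c' j) ** b j).
    by apply: gdeg_sum => j; apply: gdegM0 => //; apply: homog_scal.
  have tn : tail (1 + n) (\sum_a arr a *: z a).
    by apply: tail_sum => a; apply: tailMh => //; apply: homog_arr.
  have z0 : \sum_j aug (v j) (c' j) ** b j = 0.
    move: cb; rewrite ez => /(congr1 (hcomp n)); rewrite hcomp0 hcompD.
    by rewrite (hcomp_id dn) tn ?addr0 // ltrDr.
  split; first exact: free z0.
  by apply: (HN' n leN') => //; move: cb; rewrite ez z0 add0r.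
apply: (@pa_zeroP _ _ P).
- move=> x [c' [cv /(key c' cv)[cb _] [j ->]]] w.
  by rewrite -cv aug_Midem; case: eqP => // ->.
- move=> x a [c' [cv /(key c' cv)[_ cb] [j ->]]].
  exists (fun j => der a (c' j)); split=> //; last by exists j.
  by move=> l; rewrite -der_mul_idem cv.
- exists (fun j => c j * idem (v j)); split; last by exists i.
    by move=> j; rewrite -mulrA idem_idem eqxx.
  by rewrite -[RHS]c0; apply: eq_bigr => j _; rewrite -scalerA bv.
Qed.

End FreeTails.

(** * Shifted free modules, quotients and tails as objects *)

Definition mk_linear (R : pzRingType) (U V : lmodType R) (f : U -> V)
    (f_lin : linear f) : {linear U -> V} :=
  HB.pack f (GRing.isLinear.Build R U V *:%R f f_lin).

Section ShiftedRegularModule.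
Variables (k : fieldType) (Q : quiver) (d : int).
Local Notation kQ := (path_algebra k Q).

Lemma msuppM (x y : kQ) p : p \in msupp (x * y) ->
  exists p1 p2, [/\ p1 \in msupp x, p2 \in msupp y & pcat p1 p2 = Some p].
Proof.
move=> /msuppP ne; apply: contrapT => H; apply: ne.
rewrite -pa_mulE pa_mul.unlock coef_sum big1_seq // => p1 /= px.
rewrite coef_sum big1_seq // => p2 /= py; rewrite coefZ.
case e: (pcat p1 p2) => [r|]; last by rewrite coef0 mulr0.
rewrite basis_coef; case: eqP => [er|]; last by rewrite mulr0.
by case: H; exists p1, p2; split=> //; rewrite e er.
Qed.

Lemma pcat_plen (p q r : qpath Q) : pcat p q = Some r -> plen r = (plen p + plen q)%N.
Proof.
move=> e; have e1 : ptgt q = psrc p by move: e; rewrite /pcat; case: eqP.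
have [r'] := pcatP e1; rewrite e => -[<-] vr.
by rewrite /plen {1}/parrows vr size_cat addnC.
Qed.

(** The grading of [kQ(-d)], whose generator [1] has degree [d]; graded maps out of it correspond to
    elements of degree [d]. *)
Definition shift_deg (e : int) (x : kQ^o) : Prop :=
  forall p, p \in msupp (x : kQ) -> (plen p)%:Z + d = e.

Lemma shift_degP e (x : kQ^o) :
  shift_deg e x <-> forall p, (plen p)%:Z + d <> e -> (x : kQ)@_p = 0.
Proof.
split=> [h p ne|h p /msuppP ne]; last by apply: contrapT => /h.
by apply: mcoeff_outdom; apply/negP => /h.
Qed.

Lemma shift_deg0 e : shift_deg e 0.
Proof. by apply/shift_degP => p _; apply: coef0. Qed.

Lemma shift_degB e x y : shift_deg e x -> shift_deg e y -> shift_deg e (x - y).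
Proof.
move=> /shift_degP hx /shift_degP hy; apply/shift_degP => p ne.
by rewrite coefB hx // hy // subr0.
Qed.

Lemma shift_degM (n : nat) e (a : kQ) x :
  pa_homog n a -> shift_deg e x -> shift_deg (n%:Z + e) (a *: x).
Proof.
move=> ha hx p /msuppM[p1 [p2 [/ha <- /hx <- /pcat_plen ->]]].
by rewrite PoszD addrA.
Qed.

Lemma shift_deg_span x : exists (s : seq int) (c : int -> kQ^o),
  (forall e, shift_deg e (c e)) /\ x = \sum_(e <- s) c e.
Proof.
have [L eL] := sum_hpart x.
exists [seq n%:Z + d | n <- iota 0 L].
exists (fun e => if e - d is Posz n then hpart n x else 0); split.
  move=> e; case ed: (e - d) => [n|n]; last exact: shift_deg0.
  by move=> p /homog_hpart ->; rewrite -ed subrK.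
rewrite [LHS]eL big_map -[L in iota 0 L]subn0 -/(index_iota 0 L) big_mkord.
by apply: eq_bigr => i _; rewrite addrK.
Qed.

Lemma shift_deg_indep (s : seq int) (c : int -> kQ^o) : uniq s ->
  (forall e, shift_deg e (c e)) -> \sum_(e <- s) c e = 0 ->
  forall e, e \in s -> c e = 0.
Proof.
move=> us hc c0 e es; apply: pa_eqP => p; rewrite coef0.
case: (pselect ((plen p)%:Z + d = e)) => [pe|ne]; last first.
  by have /shift_degP := hc e; apply.
have := congr1 (fun x : kQ => x@_p) c0; rewrite /= coef0 coef_sum (bigD1_seq e) //=.
rewrite big1 ?addr0 // => e' /eqP ne.
by have /shift_degP := hc e'; apply; rewrite pe => /esym.
Qed.

Definition shift_mod : grmod k Q :=
  @GrMod k Q kQ^o shift_deg shift_deg0 shift_degB shift_degM shift_deg_span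
    shift_deg_indep.

Lemma shift_mod_fp : finitely_presented shift_mod.
Proof.
have lin : linear (fun u : 'rV[kQ]_1 => u 0 0 : kQ^o) by move=> a u v; rewrite !mxE.
exists 1%N, (mk_linear lin); split.
  by move=> x; exists (const_mx x); rewrite /= mxE.
exists 0%N, (fun=> 0) => x; split=> /= [x0|[c ->]]; last by rewrite big_ord0 mxE.
by exists (fun=> 0); rewrite big_ord0; apply/rowP => i; rewrite ord1 mxE x0.
Qed.

Lemma shift_deg_one : shift_deg d (1 : kQ).
Proof.
move=> p; rewrite -(sum_idem k Q) => /msuppP; rewrite coef_sum => ne.
have [v pv] : exists v, p = ptriv v.
  apply: contrapT => H; apply: ne; apply: big1 => v _; rewrite basis_coef.
  by case: eqP => // e; case: H; exists v.
by rewrite pv add0r.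
Qed.

Definition shift_obj : fpgrmod k Q := FpGrMod shift_mod_fp.

Definition shift_map (M : grmod k Q) (x : M) : kQ^o -> M := fun a => (a : kQ) *: x.

Lemma shift_map_linear (M : grmod k Q) (x : M) : linear (shift_map x).
Proof. by move=> a u v; rewrite /shift_map scalerDl -scalerA. Qed.

Lemma shift_map_deg (M : grmod k Q) (x : M) : gdeg d x ->
  forall e u, gdeg (g := shift_mod) e u -> gdeg e (mk_linear (shift_map_linear x) u).
Proof.
move=> dx e u /= hu; rewrite /shift_map.
(* A path in the support of [u] exhibits [e - d] as a natural number, as [gdegM] demands; below
   degree [d] there is only [0]. *)
have [n en] : exists n : nat, e = n%:Z + d \/ u = 0.
  case: (pselect (u = 0 :> kQ)) => [u0|u0]; first by exists 0%N; right.
  have [p pu] : exists p, p \in msupp (u : kQ).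
    apply: contrapT => H; apply: u0; apply: pa_eqP => p; rewrite coef0.
    by apply: mcoeff_outdom; apply/negP => pu; apply: H; exists p.
  by exists (plen p); left; rewrite (hu p pu).
case: en => [en|->]; last by rewrite scale0r; apply: gdeg0.
rewrite en; apply: gdegM => // p pu; have := hu p pu; rewrite en.
by move/addIr => -[].
Qed.

Definition shift_hom (M : fpgrmod k Q) (x : M) (dx : gdeg d x) : grhom shift_obj M :=
  @GrHom k Q shift_mod M (mk_linear (shift_map_linear x)) (shift_map_deg dx).

End ShiftedRegularModule.

(** * Quotients by graded submodules *)

Record gsubmod (k : fieldType) (Q : quiver) (M : grmod k Q) := GSubmod {
  gsub :> M -> Prop;
  gsub0 : gsub 0;
  gsubP : forall a x y, gsub x -> gsub y -> gsub (a *: x + y);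
  gsub_hcomp : forall d x, gsub x -> gsub (hcomp d x) }.

Section Quotient.
Variables (k : fieldType) (Q : quiver) (M : grmod k Q) (N : gsubmod M).
Local Notation kQ := (path_algebra k Q).
Implicit Types (x y : M).

Lemma gsubZ a x : N x -> N (a *: x).
Proof. by move=> Nx; rewrite -[_ *: x]addr0; apply: gsubP => //; apply: gsub0. Qed.

Lemma gsubD x y : N x -> N y -> N (x + y).
Proof. by move=> Nx Ny; rewrite -[x]scale1r; apply: gsubP. Qed.

Lemma gsubN x : N x -> N (- x).
Proof. by move=> Nx; rewrite -scaleN1r; apply: gsubZ. Qed.

Lemma gsub_sym x y : N (x - y) -> N (y - x).
Proof. by move=> /gsubN; rewrite opprB. Qed.

Lemma gsub_trans x y z : N (x - y) -> N (y - z) -> N (x - z).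
Proof. by move=> h h'; rewrite -(subrK y x) -addrA; apply: gsubD. Qed.

(* The quotient is the type of canonical coset representatives. *)
Definition crepr x : M := choose (fun y => `[< N (y - x) >]) x.

Lemma creprP x : N (crepr x - x).
Proof.
apply/asboolP/(@chooseP _ (fun y => `[< N (y - x) >])); apply/asboolP.
by rewrite subrr; apply: gsub0.
Qed.

Lemma crepr_eq x y : N (x - y) -> crepr x = crepr y.
Proof.
move=> h; rewrite /crepr.
have e : (fun z => `[< N (z - x) >]) =1 (fun z => `[< N (z - y) >]).
  move=> z; apply/asboolP/asboolP => h'; first exact: gsub_trans h' h.
  exact: gsub_trans h' (gsub_sym h).
rewrite (eq_choose e); apply: choose_id; apply/asboolP => //.
by rewrite subrr; apply: gsub0.
Qed.

Lemma crepr_idem x : crepr (crepr x) == crepr x.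
Proof. by apply/eqP/crepr_eq/creprP. Qed.

Definition quot : Type := {x : M | crepr x == x}.

HB.instance Definition _ := Choice.on quot.

Definition qproj x : quot := exist _ (crepr x) (crepr_idem x).

Lemma qproj_eq x y : N (x - y) -> qproj x = qproj y.
Proof. by move=> h; apply: val_inj; apply: crepr_eq. Qed.

Lemma qproj_eqP x y : qproj x = qproj y -> N (x - y).
Proof.
move=> /(congr1 val) /= e; apply: gsub_trans (gsub_sym (creprP x)) _.
by rewrite e; apply: creprP.
Qed.

Lemma qproj_val (u : quot) : qproj (val u) = u.
Proof. by apply: val_inj; apply/eqP; exact: (valP u). Qed.

Definition qadd (u v : quot) := qproj (val u + val v).
Definition qopp (u : quot) := qproj (- val u).
Definition qscale (a : kQ) (u : quot) := qproj (a *: val u).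

Lemma qaddE x y : qadd (qproj x) (qproj y) = qproj (x + y).
Proof. by apply: qproj_eq; rewrite opprD addrACA; apply: gsubD; apply: creprP. Qed.

Lemma qoppE x : qopp (qproj x) = qproj (- x).
Proof. by apply: qproj_eq; rewrite -opprD; apply/gsubN/creprP. Qed.

Lemma qscaleE a x : qscale a (qproj x) = qproj (a *: x).
Proof. by apply: qproj_eq; rewrite -scalerBr; apply/gsubZ/creprP. Qed.

Lemma qaddA : associative qadd.
Proof.
move=> u v w; rewrite -(qproj_val u) -(qproj_val v) -(qproj_val w).
by rewrite !qaddE addrA.
Qed.

Lemma qaddC : commutative qadd.
Proof. by move=> u v; rewrite /qadd addrC. Qed.

Lemma qadd0 : left_id (qproj 0) qadd.
Proof. by move=> u; rewrite -(qproj_val u) qaddE add0r. Qed.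

Lemma qaddN : left_inverse (qproj 0) qopp qadd.
Proof. by move=> u; rewrite -(qproj_val u) qoppE qaddE addNr. Qed.

HB.instance Definition _ := GRing.isZmodule.Build quot qaddA qaddC qadd0 qaddN.

Lemma qscaleA a b u : qscale a (qscale b u) = qscale (a * b) u.
Proof. by rewrite -(qproj_val u) !qscaleE scalerA. Qed.

Lemma qscale1 : left_id 1 qscale.
Proof. by move=> u; rewrite -(qproj_val u) qscaleE scale1r. Qed.

Lemma qscaleDr : right_distributive qscale +%R.
Proof.
move=> a u v; rewrite -(qproj_val u) -(qproj_val v).
by rewrite -[_ + _]/(qadd _ _) -[RHS]/(qadd _ _) qaddE !qscaleE qaddE scalerDr.
Qed.

Lemma qscaleDl u : {morph qscale^~ u : a b / a + b}.
Proof.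
move=> a b; rewrite -(qproj_val u) -[RHS]/(qadd _ _) !qscaleE qaddE.
by rewrite scalerDl.
Qed.

HB.instance Definition _ :=
  GRing.Zmodule_isLmodule.Build kQ quot qscaleA qscale1 qscaleDr qscaleDl.

Lemma qproj_linear : linear qproj.
Proof. by move=> a x y; rewrite -[RHS]/(qadd (qscale _ _) _) qscaleE qaddE. Qed.

Definition qlin : {linear M -> quot} := mk_linear qproj_linear.

Lemma qlin_eq0 x : N x -> qlin x = 0.
Proof. by move=> Nx; apply: qproj_eq; rewrite subr0. Qed.

Lemma qlin_eq0P x : qlin x = 0 -> N x.
Proof. by move=> /qproj_eqP; rewrite subr0. Qed.

Lemma qlin_surj u : exists x, u = qlin x.
Proof. by exists (val u); rewrite /= qproj_val. Qed.

Definition qdeg d (u : quot) : Prop := exists2 x, gdeg d x & u = qlin x.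

Lemma qdeg0 d : qdeg d 0.
Proof. by exists 0; rewrite ?linear0 //; apply: gdeg0. Qed.

Lemma qdegB d u v : qdeg d u -> qdeg d v -> qdeg d (u - v).
Proof.
by move=> [x dx ->] [y dy ->]; exists (x - y); rewrite ?linearB //; apply: gdegB.
Qed.

Lemma qdegM (n : nat) d (a : kQ) u : pa_homog n a -> qdeg d u -> qdeg (n%:Z + d) (a *: u).
Proof.
by move=> ha [x dx ->]; exists (a *: x); [apply: gdegM | rewrite linearZ].
Qed.

Lemma qdeg_span u : exists (s : seq int) (c : int -> quot),
  (forall d, qdeg d (c d)) /\ u = \sum_(d <- s) c d.
Proof.
have [x ->] := qlin_surj u; have [s [_ _ ex]] := hcomp_sum x.
exists s, (fun d => qlin (hcomp d x)); split.
  by move=> d; exists (hcomp d x) => //; apply: hcomp_deg.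
by rewrite {1}ex linear_sum.
Qed.

(** Homogeneous representatives sum to an element of [N], and [N] contains the components of its
    elements. *)
Lemma qdeg_indep (s : seq int) (c : int -> quot) : uniq s ->
  (forall d, qdeg d (c d)) -> \sum_(d <- s) c d = 0 ->
  forall d, d \in s -> c d = 0.
Proof.
move=> us dc c0 d ds.
have [x Hx] := choice (fun d => let: ex_intro2 x dx e := dc d in
  ex_intro (fun x => gdeg d x /\ c d = qlin x) x (conj dx e)).
rewrite (Hx d).2; apply: qlin_eq0.
have: N (\sum_(e <- s) x e).
  by apply: qlin_eq0P; rewrite linear_sum -[RHS]c0; apply: eq_bigr => e _; rewrite (Hx e).2.
move=> /(gsub_hcomp d); rewrite hcomp_bigsum (bigD1_seq d) //= big1 ?addr0.
  by rewrite hcomp_id //; case: (Hx d).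
move=> e ne; rewrite (hcomp_homog _ (Hx e).1).
by rewrite eq_sym (negbTE ne).
Qed.

Definition quot_mod : grmod k Q :=
  @GrMod k Q quot qdeg qdeg0 qdegB qdegM qdeg_span qdeg_indep.

Lemma split_lshift m n (i : 'I_m) : split (lshift n i) = inl i.
Proof. exact: (unsplitK (inl i)). Qed.

Lemma split_rshift m n (i : 'I_n) : split (rshift m i) = inr i.
Proof. exact: (unsplitK (inr i)). Qed.

(** The relations are those of [M] together with lifts to the free cover of the generators of
    [N]. *)
Lemma quot_mod_fp s (g : 'I_s -> M) : finitely_presented M ->
  (forall x, N x <-> exists c : 'I_s -> kQ, x = \sum_i c i *: g i) ->
  finitely_presented quot_mod.
Proof.
move=> [r [phi [phiS [q [rel relP]]]]] gP.
have [h Hh] := choice (fun i => phiS (g i)).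
have lin : linear (fun u => qlin (phi u)) by move=> a x y; rewrite !linearP.
exists r, (mk_linear lin); split.
  move=> u; have [x ->] := qlin_surj u; have [y <-] := phiS x.
  by exists y.
exists (q + s)%N, (fun i => match split i with inl i => rel i | inr i => h i end) => x.
split=> [x0|[c ->]] /=.
  have /gP[c ec] := qlin_eq0P x0.
  have : phi (x - \sum_i c i *: h i) = 0.
    rewrite linearB linear_sum /= ec; apply/eqP; rewrite subr_eq0; apply/eqP.
    by apply: eq_bigr => i _; rewrite linearZ /= Hh.
  move=> /relP[e ee].
  exists (fun i => match split i with inl i => e i | inr i => c i end).
  rewrite big_split_ord /= -[x](subrK (\sum_i c i *: h i)) ee; congr (_ + _).
    by apply: eq_bigr => i _; rewrite split_lshift.
  by apply: eq_bigr => i _; rewrite split_rshift.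
apply: qlin_eq0; rewrite big_split_ord linearD; apply: gsubD.
  suff -> : phi (\sum_(i < q) c (lshift s i) *: match split (lshift s i) with
     inl i => rel i | inr i => h i end) = 0 by apply: gsub0.
  apply/relP; exists (fun i => c (lshift s i)); apply: eq_bigr => i _.
  by rewrite split_lshift.
apply/gP; exists (fun i => c (rshift q i)); rewrite linear_sum; apply: eq_bigr => i _.
rewrite linearZ /=; congr (_ *: _).
by rewrite split_rshift Hh.
Qed.

End Quotient.

(** * Truncations as graded modules *)

Section TailModule.
Variables (k : fieldType) (Q : quiver) (M : grmod k Q) (n : int).
Local Notation kQ := (path_algebra k Q).

Definition tail_pred : {pred M} := fun x => `[< tail n x >].

Lemma tail_predP x : reflect (tail n x) (x \in tail_pred).
Proof. exact: asboolP. Qed.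

Lemma tail_submod : submod_closed tail_pred.
Proof.
split=> [|a x y /tail_predP tx /tail_predP ty]; apply/tail_predP; first exact: tail0.
by apply: tailD => //; apply: tailM.
Qed.

HB.instance Definition _ := GRing.isSubmodClosed.Build kQ M tail_pred tail_submod.

Definition tailT := {x : M | x \in tail_pred}.

HB.instance Definition _ := SubChoice.on tailT.
HB.instance Definition _ := [SubChoice_isSubLmodule of tailT by <:].

Definition tdeg d (u : tailT) : Prop := gdeg d (val u).

Lemma tval_tail (u : tailT) : tail n (val u).
Proof. by apply/tail_predP; apply: valP. Qed.

Definition intail x (tx : tail n x) : tailT := exist _ x (introT (tail_predP x) tx).

Lemma tdeg0 d : tdeg d 0. Proof. by rewrite /tdeg linear0; apply: gdeg0. Qed.

Lemma tdegB d u v : tdeg d u -> tdeg d v -> tdeg d (u - v).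
Proof. by move=> du dv; rewrite /tdeg linearB; apply: gdegB. Qed.

Lemma tdegM (m : nat) d (a : kQ) u : pa_homog m a -> tdeg d u -> tdeg (m%:Z + d) (a *: u).
Proof. by move=> ha du; rewrite /tdeg linearZ; apply: gdegM. Qed.

Lemma tdeg_span u : exists (s : seq int) (c : int -> tailT),
  (forall d, tdeg d (c d)) /\ u = \sum_(d <- s) c d.
Proof.
have [s [_ _ eu]] := hcomp_sum (val u).
exists s, (fun d => intail (tail_hcomp d (tval_tail u))); split.
  by move=> d; apply: hcomp_deg.
by apply: val_inj; rewrite linear_sum.
Qed.

Lemma tdeg_indep (s : seq int) (c : int -> tailT) : uniq s ->
  (forall d, tdeg d (c d)) -> \sum_(d <- s) c d = 0 ->
  forall d, d \in s -> c d = 0.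
Proof.
move=> us dc c0 d ds; apply: val_inj; rewrite linear0.
apply: (@gdeg_indep _ _ M s (fun d => val (c d))) => //.
by rewrite -linear_sum c0 linear0.
Qed.

Definition tail_mod : grmod k Q :=
  @GrMod k Q tailT tdeg tdeg0 tdegB tdegM tdeg_span tdeg_indep.

Lemma val_tail_linear : linear (val : tailT -> M).
Proof. by move=> a u v; rewrite linearP. Qed.

Definition tail_incl : grhom tail_mod M :=
  @GrHom k Q tail_mod M (mk_linear val_tail_linear) (fun d u du => du).

Lemma tail_mod_fp r (b : 'I_r -> M) v : free_tail n b v -> finitely_presented tail_mod.
Proof.
move=> [bd bv bS free].
have bt i : tail n (b i) by apply: tail_deg (bd i) _.
pose f (u : 'rV[kQ]_r) := \sum_i u 0 i *: intail (bt i).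
have lin : linear f.
  move=> a x y; rewrite /f scaler_sumr -big_split; apply: eq_bigr => i _ /=.
  by rewrite !mxE scalerDl scalerA.
have fE u : val (f u) = \sum_i u 0 i *: b i.
  by rewrite linear_sum; apply: eq_bigr => i _; rewrite linearZ.
exists r, (mk_linear lin); split.
  move=> u; have [c ec] := bS _ (tval_tail u); exists (\row_i c i).
  apply: val_inj; rewrite [LHS]fE ec; apply: eq_bigr => i _.
  by rewrite mxE.
(* The kernel of the map from [kQ] onto [kQ e_v] sending [1] to [e_v] is [kQ (1 - e_v)], so one
   relation for each generator suffices. *)
exists r, (fun i => (1 - idem k (v i)) *: delta_mx 0 i) => x; split=> [x0|[c ->]].
  exists (fun i => x 0 i); rewrite {1}[x]row_sum_delta; apply: eq_bigr => i _.
  rewrite scalerA mulrBr mulr1 (free (fun i => x 0 i)) ?subr0 //.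
  by rewrite -fE -[f x]/(mk_linear lin x) x0 linear0.
rewrite linear_sum big1 // => i _; rewrite !linearZ /=; apply: val_inj.
rewrite !linearZ linear0 /= fE (bigD1 i) //= big1 => [|j ne]; last first.
  by rewrite mxE (negbTE ne) andbF scale0r.
by rewrite mxE !eqxx scale1r addr0 scalerBl scale1r bv subrr scaler0.
Qed.

End TailModule.

(** * Zero morphisms, cokernels and the morphisms inverted in the quotient *)

Section FinitelyPresentedObjects.
Variables (k : fieldType) (Q : quiver).
Local Notation kQ := (path_algebra k Q).
Local Notation "c ** x" := (kscal Q c *: x) (at level 40, left associativity).

Lemma rV0_span (x : 'rV[kQ]_0) : exists (s : seq int) (c : int -> 'rV[kQ]_0),
  (forall d : int, True) /\ x = \sum_(d <- s) c d.
Proof. by exists [::], (fun=> 0); split=> //; rewrite big_nil thinmx0. Qed.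

Definition zero_mod : grmod k Q :=
  @GrMod k Q 'rV[kQ]_0 (fun _ _ => True) (fun _ => I) (fun _ _ _ _ _ => I)
    (fun _ _ _ _ _ _ => I) rV0_span (fun _ _ _ _ _ _ _ => thinmx0 _).

Lemma zero_mod_eq0 (x : zero_mod) : x = 0.
Proof. exact: thinmx0. Qed.

Lemma zero_mod_fp : finitely_presented zero_mod.
Proof.
exists 0%N, (idfun : {linear 'rV[kQ]_0 -> 'rV[kQ]_0}); split; first by move=> y; exists y.
exists 0%N, (fun=> 0) => x; split=> [_|_]; last exact: thinmx0.
by exists (fun=> 0); rewrite big_ord0 thinmx0.
Qed.

Definition zero_fp : gr k Q := FpGrMod zero_mod_fp.

Lemma zero_linear (U V : lmodType kQ) : linear (fun _ : U => 0 : V).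
Proof. by move=> a x y; rewrite scaler0 addr0. Qed.

Definition grhom0 (M N : grmod k Q) : grhom M N :=
  @GrHom k Q M N (mk_linear (@zero_linear M N)) (fun d _ _ => gdeg0 N d).

Lemma gr_zero_fp : is_zero_obj zero_fp.
Proof.
split=> X; first exists (grhom0 zero_fp (X : fpgrmod k Q)) => g x.
  by rewrite (zero_mod_eq0 x) !linear0.
by exists (grhom0 (X : fpgrmod k Q) zero_fp) => g x; exact: zero_mod_eq0.
Qed.

Lemma gr_zeroP (X Y : gr k Q) (f : mor X Y) :
  is_zero_mor f <-> forall x : (X : fpgrmod k Q), (f : grhom X Y) x = 0.
Proof.
split=> [[Z [[ZI _] [a [b e]]]] x|f0].
  have [h Hh] := ZI Z; rewrite (e x) /=.
  (* An initial object has a single endomorphism, so its identity is the zero map. *)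
  have e1 : a x = 0.
    have /(_ (a x)) /= -> := Hh (grhom_id (Z : fpgrmod k Q)).
    by have /(_ (a x)) /= <- := Hh (grhom0 (Z : fpgrmod k Q) Z).
  by rewrite e1 linear0.
exists zero_fp; split; first exact: gr_zero_fp.
by exists (grhom0 (X : fpgrmod k Q) zero_mod), (grhom0 zero_mod (Y : fpgrmod k Q)).
Qed.

Lemma fdimP (M : gr k Q) (T : finType) (b : T -> (M : fpgrmod k Q)) :
  (forall x, exists c : T -> k, x = \sum_t c t ** b t) -> fdim M.
Proof.
move=> bS; exists #|T|, (fun i : 'I_#|T| => b (enum_val i)) => x.
have [c ->] := bS x; exists (fun i : 'I_#|T| => c (enum_val i)).
rewrite (reindex (fun i : 'I_#|T| => enum_val i)); last exact/onW_bij/enum_val_bij.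
by apply: eq_bigr => i _; rewrite kscal.unlock.
Qed.

Lemma fdim_bounded (M : gr k Q) : fdim M ->
  eventually (fun d => forall x : (M : fpgrmod k Q), gdeg d x -> x = 0).
Proof.
move=> [n [b bS]].
have [N HN] := eventually_all (fun i => hcomp_eventually0 (b i)).
exists N => d le x dx; have [c ex0] := bS x.
have ex : x = \sum_i c i ** b i by rewrite ex0; apply: eq_bigr => i _; rewrite kscal.unlock.
rewrite -(hcomp_id dx) ex hcomp_bigsum big1 // => i _.
by rewrite hcompM0 ?HN ?scaler0 //; apply: homog_scal.
Qed.

Section Image.
Variables (X Y : fpgrmod k Q) (w : grhom X Y).

Lemma image0 : exists x, 0 = w x. Proof. by exists 0; rewrite linear0. Qed.

Lemma imageP a y y' : (exists x, y = w x) -> (exists x, y' = w x) ->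
  exists x, a *: y + y' = w x.
Proof. by move=> [x ->] [x' ->]; exists (a *: x + x'); rewrite linearP. Qed.

Lemma image_hcomp d y : (exists x, y = w x) -> exists x, hcomp d y = w x.
Proof. by move=> [x ->]; exists (hcomp d x); rewrite hcomp_hom. Qed.

Definition image := GSubmod image0 imageP image_hcomp.

Lemma image_fg : exists s (g : 'I_s -> Y), forall y,
  image y <-> exists c : 'I_s -> kQ, y = \sum_i c i *: g i.
Proof.
have [s [g gS]] := fp_fg (fpgr_fp X); exists s, (fun i => w (g i)) => y.
have e c : \sum_i c i *: w (g i) = w (\sum_i c i *: g i).
  by rewrite linear_sum; apply: eq_bigr => i _; rewrite linearZ.
split=> [[x ->]|[c ->]]; last by rewrite e; exists (\sum_i c i *: g i).
by have [c ->] := gS x; exists c; rewrite e.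
Qed.

End Image.

Definition quot_hom (M : grmod k Q) (N : gsubmod M) : grhom M (quot_mod N) :=
  @GrHom k Q M (quot_mod N) (qlin N) (fun d x dx => ex_intro2 _ _ x dx erefl).

Lemma quot_cokernel (X Y : fpgrmod k Q) (w : grhom X Y) (N : gsubmod Y)
    (fpN : finitely_presented (quot_mod N)) :
  (forall y, N y <-> exists x, y = w x) ->
  @is_cokernel (gr k Q) X Y (FpGrMod fpN) w (quot_hom N).
Proof.
move=> NP; split.
  by apply/gr_zeroP => x /=; apply: qlin_eq0; apply/NP; exists x.
move=> T t /gr_zeroP t0.
have tN y : N y -> (t : grhom Y T) y = 0 by move=> /NP[x ->]; apply: t0.
pose u (z : quot N) : (T : fpgrmod k Q) := (t : grhom Y T) (val z).
have uE y : u (qlin N y) = (t : grhom Y T) y.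
  by apply/eqP; rewrite -subr_eq0 -linearB tN //; apply: creprP.
have ulin : linear u.
  move=> a z z'; have [x ->] := qlin_surj z; have [x' ->] := qlin_surj z'.
  by rewrite -linearP !uE linearP.
have udeg d (z : quot_mod N) : gdeg d z -> gdeg d (mk_linear ulin z).
  by move=> [x dx ->]; rewrite /= uE; apply: ghom_deg.
exists (@GrHom k Q (quot_mod N) (T : fpgrmod k Q) (mk_linear ulin) udeg).
split=> [y|u' eu' z] /=; first exact: uE.
have [y ->] := qlin_surj z.
by rewrite uE; apply: (eu' y).
Qed.

(* Maps out of the free modules on one generator of degree [d] see the elements
   of the kernel; the quotient by the image sees those of the cokernel. *)
Lemma iso_modulo_bij (X Y : gr k Q) (w : mor X Y) : iso_modulo (@fdim k Q) w ->
  eventually (fun n => (forall x : (X : fpgrmod k Q), tail n x -> (w : grhom X Y) x = 0 -> x = 0)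
    /\ (forall y : (Y : fpgrmod k Q), tail n y -> exists2 x, tail n x & (w : grhom X Y) x = y)).
Proof.
move=> [[K [i [fK [/gr_zeroP wi0 iU]]]] [L [p [fL [/gr_zeroP pw0 pU]]]]].
have [N HN] := fdim_bounded fK; have [N' HN'] := fdim_bounded fL.
exists (`|N| + `|N'|) => n le; split.
  move=> x tx wx0; apply: (tail_comp_eq0 tx) => d led.
  pose t : mor (shift_obj k Q d : gr k Q) X := shift_hom (hcomp_deg d x).
  have [|u [eu _]] := iU _ t.
    apply/gr_zeroP => a /=; rewrite /shift_map linearZ /= -hcomp_hom wx0 hcomp0.
    by rewrite scaler0.
  have u1 : (u : grhom (shift_obj k Q d) K) (1 : kQ) = 0.
    apply: (HN d); first lia.
    exact/ghom_deg/shift_deg_one.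
  by have := eu (1 : kQ); rewrite /= u1 linear0 /shift_map scale1r => <-.
have [s [g gP]] := image_fg (w : grhom X Y).
have fpq := quot_mod_fp (fpgr_fp (Y : fpgrmod k Q)) gP.
pose t : mor Y (FpGrMod fpq : gr k Q) := quot_hom (image (w : grhom X Y)).
have [|u [eu _]] := pU _ t.
  by apply/gr_zeroP => x; apply: qlin_eq0; exists x.
(* [p] sends [y] into a vanishing component of [L], and the projection modulo the image factors
   through [p], so [y] lies in the image. *)
have low d y : n <= d -> gdeg d y -> exists2 x, gdeg d x & (w : grhom X Y) x = y.
  move=> led dy; have py0 : (p : grhom Y L) y = 0.
    by apply: (HN' d); [lia | apply: ghom_deg].
  have := eu y; rewrite /= py0 linear0 => /esym /qlin_eq0P[x ex].
  exists (hcomp d x); first exact: hcomp_deg.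
  by rewrite -hcomp_hom -ex hcomp_id.
apply: tail_ind.
- by exists 0; [exact: tail0 | rewrite linear0].
- move=> y y' [x tx <-] [x' tx' <-]; exists (x + x'); first exact: tailD.
  by rewrite linearD.
by move=> d y led dy; have [x dx <-] := low d y led dy; exists x => //; apply: tail_deg dx led.
Qed.

Definition fp_tail (M : fpgrmod k Q) n := finitely_presented (tail_mod M n).

Lemma eventually_fp_tail (M : fpgrmod k Q) : eventually (fp_tail M).
Proof.
apply: eventually_imp (fp_free_tail (fpgr_fp M)) => n [r [b [v fr]]].
exact: tail_mod_fp fr.
Qed.

Lemma tail_linear (M : grmod k Q) n a (x y : M) :
  tail n x -> tail n y -> tail n (a *: x + y).
Proof. by move=> tx ty; apply: tailD => //; apply: tailM. Qed.

Definition tail_gsub (M : grmod k Q) n : gsubmod M :=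
  @GSubmod k Q M (@tail k Q M n) (@tail0 k Q M n) (@tail_linear M n)
    (@tail_hcomp k Q M n).

(** Multiples of the generators by long paths lie in the tail, so the quotient is spanned by the
    finitely many multiples by short paths. *)
Lemma tail_quot_fdim (M : fpgrmod k Q) n (fpq : finitely_presented (quot_mod (tail_gsub M n))) :
  fdim (FpGrMod fpq : gr k Q).
Proof.
have [r [g gS]] := fp_fg (fpgr_fp M).
have [L0 HL0] := choice (fun i => hcomp_low (g i) n).
pose L := \max_i L0 i.
pose T := ('I_r * (vertex Q * L.-bseq (arrow Q)))%type.
apply: (@fdimP (FpGrMod fpq : gr k Q) T
  (fun t : T => qlin (tail_gsub M n) (short_path k t.2 *: g t.1))) => u.
have [x ->] := qlin_surj u; have [c ->] := gS x.
have [cc Hcc] := choice (fun i => short_path_decomp L (c i)).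
exists (fun t : T => cc t.1 t.2).
apply: etrans (pair_bigA _ (fun i t => cc i t ** qlin (tail_gsub M n) (short_path k t *: g i))).
rewrite linear_sum; apply: eq_bigr => i _; have [y [-> hy]] := Hcc i.
rewrite scalerDl linearD [X in _ + X]qlin_eq0 ?addr0; last first.
  move=> d lt; apply: (@hcomp_long_path _ _ _ _ L) => // l ltl.
  by apply: (HL0 i L) (ltW lt) => //; apply: leq_bigmax.
rewrite scaler_suml linear_sum; apply: eq_bigr => t _.
by rewrite kscaleA linearZ.
Qed.

(** The kernel is zero and the cokernel is [M / M_{>=n}], which is an object of [gr] because the
    tail is finitely generated. *)
Lemma tail_incl_iso_modulo (M : fpgrmod k Q) n (h : fp_tail M n) :
  @iso_modulo (gr k Q) (@fdim k Q) (FpGrMod h) M (tail_incl M n).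
Proof.
split.
  exists zero_fp, (grhom0 zero_mod (tail_mod M n)); split.
    apply: (@fdimP zero_fp void (fun=> 0)) => x; exists (fun=> 0).
    by rewrite (zero_mod_eq0 x) big1 // => t; case: t.
  split; first by apply/gr_zeroP => x /=.
  move=> T t /gr_zeroP t0; exists (grhom0 (T : fpgrmod k Q) zero_mod); split.
    by move=> x /=; apply: val_inj; rewrite linear0; apply/esym/t0.
  by move=> u' _ x; exact: zero_mod_eq0.
have NP (y : M) : tail_gsub M n y <-> exists x, y = tail_incl M n x.
  split=> [ty|[x ->]]; last exact: tval_tail.
  by exists (intail ty).
have [s [g gP]] := @image_fg (FpGrMod h) M (tail_incl M n).
have gP' y : tail_gsub M n y <-> exists c : 'I_s -> kQ, y = \sum_i c i *: g i.
  by rewrite NP; apply: gP.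
have fpq := quot_mod_fp (fpgr_fp M) gP'.
exists (FpGrMod fpq), (quot_hom (tail_gsub M n)); split.
  exact: tail_quot_fdim.
exact: (@quot_cokernel (FpGrMod h) M (tail_incl M n)).
Qed.

End FinitelyPresentedObjects.

(** * The quotient category as a category of germs *)

Section Germs.
Variables (k : fieldType) (Q : quiver).
Local Notation kQ := (path_algebra k Q).
Implicit Types (X Y Z : grmod k Q) (n d : int).

(* [phi] restricts to a morphism on the tail [n]; its other values are junk. *)
Definition homgerm_at X Y n (phi : X -> Y) : Prop :=
  (forall a x y, tail n x -> tail n y -> phi (a *: x + y) = a *: phi x + phi y) /\
  (forall d x, n <= d -> gdeg d x -> gdeg d (phi x)).

Definition homgerm X Y (phi : X -> Y) := eventually (fun n => homgerm_at n phi).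

Definition germ_eq X Y (phi psi : X -> Y) :=
  eventually (fun n => forall x, tail n x -> phi x = psi x).

Lemma homgerm_at_le X Y m n (phi : X -> Y) : m <= n -> homgerm_at m phi -> homgerm_at n phi.
Proof.
move=> le [lin deg]; split=> [a x y tx ty|d x led].
  by apply: lin; apply: tail_le le _.
by apply: deg; apply: le_trans led.
Qed.

Lemma homgermP X Y (phi : X -> Y) n : homgerm_at n phi -> homgerm phi.
Proof. by move=> h; exists n => m le; apply: homgerm_at_le h. Qed.

Section HomgermAt.
Variables (X Y : grmod k Q) (n : int) (phi : X -> Y).
Hypothesis phi_homgerm : homgerm_at n phi.

Lemma homgerm_at_add x y : tail n x -> tail n y -> phi (x + y) = phi x + phi y.
Proof. by move=> tx ty; rewrite -[x]scale1r phi_homgerm.1 // !scale1r. Qed.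

Lemma homgerm_at0 : phi 0 = 0.
Proof. by apply: addr_idem_eq0; rewrite -homgerm_at_add ?addr0 //; apply: tail0. Qed.

Lemma homgerm_at_scale a x : tail n x -> phi (a *: x) = a *: phi x.
Proof.
move=> tx; have := phi_homgerm.1 a x 0 tx (@tail0 _ _ X n).
by rewrite homgerm_at0 !addr0.
Qed.

Lemma homgerm_at_opp x : tail n x -> phi (- x) = - phi x.
Proof. by move=> tx; rewrite -scaleN1r homgerm_at_scale // scaleN1r. Qed.

Lemma homgerm_at_hcomp d x : tail n x -> hcomp d (phi x) = phi (hcomp d x).
Proof.
move=> tx; rewrite -{1}[d]add0r; apply: (@hcomp_map _ _ X Y (tail n)) tx => //.
- exact: tail0.
- by move=> y z; apply: tailD.
- by move=> e y; apply: tail_hcomp.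
- exact: homgerm_at_add.
move=> e y dy ty; rewrite add0r.
have [le|lt] := leP n e; first exact: phi_homgerm.2.
by rewrite -(hcomp_id dy) ty // homgerm_at0; apply: gdeg0.
Qed.

Lemma homgerm_at_tail m x : n <= m -> tail m x -> tail m (phi x).
Proof.
move=> le tx d lt; rewrite homgerm_at_hcomp; last exact: tail_le tx.
by rewrite tx // homgerm_at0.
Qed.

Lemma restrict_linear : linear (fun u : tailT X n => phi (val u)).
Proof. by move=> a u v; rewrite linearP phi_homgerm.1 //; apply: tval_tail. Qed.

Lemma restrict_deg d (u : tail_mod X n) :
  gdeg d u -> gdeg d (mk_linear restrict_linear u).
Proof.
move=> du /=; have [le|lt] := leP n d; first exact: phi_homgerm.2.
by rewrite -(hcomp_id (du : gdeg d (val u))) tval_tail // homgerm_at0; apply: gdeg0.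
Qed.

Definition restrict : grhom (tail_mod X n) Y :=
  @GrHom k Q (tail_mod X n) Y (mk_linear restrict_linear) restrict_deg.

Lemma corestrict_linear :
  linear (fun u : tailT X n => intail (homgerm_at_tail (lexx n) (tval_tail u))).
Proof.
move=> a u v; apply: val_inj; apply: etrans (restrict_linear a u v) _.
by rewrite [RHS]linearP.
Qed.

(** Keeping the same [n] on both sides lets germs restricted at a common degree be composed as
    graded morphisms. *)
Definition corestrict : grhom (tail_mod X n) (tail_mod Y n) :=
  @GrHom k Q (tail_mod X n) (tail_mod Y n) (mk_linear corestrict_linear)
    restrict_deg.

End HomgermAt.

Lemma homgerm_grhom X Y (f : grhom X Y) : homgerm f.
Proof.
apply: (@homgermP _ _ _ 0); split=> [a x y _ _|d x _ dx]; first by rewrite linearP.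
exact: ghom_deg.
Qed.

Lemma homgerm_comp X Y Z (psi : Y -> Z) (phi : X -> Y) :
  homgerm psi -> homgerm phi -> homgerm (psi \o phi).
Proof.
move=> gpsi gphi; have [n Hn] := eventually_and gpsi gphi.
have [h1 h2] := Hn n (lexx n); apply: (@homgermP _ _ _ n); split.
  by move=> a x y tx ty /=; rewrite h2.1 // h1.1 //; apply: (homgerm_at_tail h2).
by move=> d x le dx; apply: h1.2 => //; apply: h2.2.
Qed.

Lemma homgerm_add X Y (phi psi : X -> Y) :
  homgerm phi -> homgerm psi -> homgerm (fun x => phi x + psi x).
Proof.
move=> gphi gpsi; have [n Hn] := eventually_and gphi gpsi.
have [h1 h2] := Hn n (lexx n); apply: (@homgermP _ _ _ n); split.
  by move=> c x y tx ty; rewrite h1.1 // h2.1 // scalerDr addrACA.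
by move=> d x le dx; apply: gdegD; [apply: h1.2 | apply: h2.2].
Qed.

Lemma homgerm_opp X Y (phi : X -> Y) : homgerm phi -> homgerm (fun x => - phi x).
Proof.
apply: eventually_imp => n h; split; last first.
  by move=> d x le dx; apply/gdegN/h.2.
by move=> c x y tx ty; rewrite h.1 // scalerN opprD.
Qed.

Lemma germ_eq_trans X Y (phi psi chi : X -> Y) :
  germ_eq phi psi -> germ_eq psi chi -> germ_eq phi chi.
Proof.
move=> e e'; apply: eventually_imp (eventually_and e e') => n [h h'] x tx.
by rewrite h // h'.
Qed.

Lemma germ_eq_sym X Y (phi psi : X -> Y) : germ_eq phi psi -> germ_eq psi phi.
Proof. by apply: eventually_imp => n h x tx; rewrite h. Qed.

Lemma germ_eq_refl X Y (phi psi : X -> Y) : phi =1 psi -> germ_eq phi psi.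
Proof. by move=> e; exists 0 => n _ x _; apply: e. Qed.

Lemma eventually_tail X Y (phi : X -> Y) : homgerm phi ->
  eventually (fun n => forall x, tail n x -> tail n (phi x)).
Proof. by apply: eventually_imp => n h x; apply: (homgerm_at_tail h). Qed.

Lemma germ_eq_comp X Y Z (psi psi' : Y -> Z) (phi phi' : X -> Y) : homgerm phi ->
  germ_eq psi psi' -> germ_eq phi phi' -> germ_eq (psi \o phi) (psi' \o phi').
Proof.
move=> /eventually_tail g e e'.
apply: eventually_imp (eventually_and g (eventually_and e e')) => n [h1 [h2 h3]] x tx /=.
by rewrite -h3 // h2 //; apply: h1.
Qed.

(** * Interpretation of zigzags as germs *)

Local Notation W := (@iso_modulo (gr k Q) (@fdim k Q)).
Local Notation zz := (@zigzag (gr k Q) W).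

(** Preimages are chosen pointwise on a tail where [w] is bijective; injectivity there makes the
    choice linear and homogeneous. *)
Lemma weak_inverse (X Y : gr k Q) (w : mor X Y) : W w ->
  exists phi : (Y : fpgrmod k Q) -> (X : fpgrmod k Q), homgerm phi /\
  eventually (fun n =>
    (forall y, tail n y -> (w : grhom X Y) (phi y) = y) /\
    (forall x, tail n x -> phi ((w : grhom X Y) x) = x)).
Proof.
move=> /iso_modulo_bij[N HN]; have [inj surj] := HN N (lexx N).
have ex (y : (Y : fpgrmod k Q)) : exists x, tail N y -> tail N x /\ (w : grhom X Y) x = y.
  case: (pselect (tail N y)) => [ty|nty]; last by exists 0.
  by have [x tx ex] := surj y ty; exists x.
have [phi Hphi] := choice ex; exists phi.
have tphi y : tail N y -> tail N (phi y) by move=> /Hphi[].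
have wphi y : tail N y -> (w : grhom X Y) (phi y) = y by move=> /Hphi[].
have winj x x' : tail N x -> tail N x' -> (w : grhom X Y) x = (w : grhom X Y) x' -> x = x'.
  move=> tx tx' e; apply/eqP; rewrite -subr_eq0; apply/eqP/inj.
    by apply: tailD => //; apply: tailN.
  by rewrite linearB e subrr.
split.
  apply: (@homgermP _ _ _ N); split=> [a y y' ty ty'|d y le dy].
    have t1 : tail N (a *: y + y') by apply: tail_linear.
    apply: winj; [exact: tphi | by apply: tail_linear; apply: tphi |].
    by rewrite linearP !wphi.
  have ty : tail N y by apply: tail_deg dy le.
  suff -> : phi y = hcomp d (phi y) by apply: hcomp_deg.
  apply: winj; [exact: tphi | exact/tail_hcomp/tphi |].
  by rewrite -hcomp_hom wphi // hcomp_id.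
exists N => n le; split=> [y ty|x tx]; first by apply: wphi; apply: tail_le le _.
have tx' : tail N x by apply: tail_le le _.
have twx : tail N ((w : grhom X Y) x) by apply: tail_hom.
by apply: winj => //; [apply: tphi | rewrite wphi].
Qed.

Definition winv (X Y : gr k Q) (w : mor X Y) (Ww : W w) :
  (Y : fpgrmod k Q) -> (X : fpgrmod k Q) := projT1 (cid (weak_inverse Ww)).

Lemma winv_homgerm (X Y : gr k Q) (w : mor X Y) (Ww : W w) : homgerm (winv Ww).
Proof. by rewrite /winv; case: cid => phi []. Qed.

Lemma winvK (X Y : gr k Q) (w : mor X Y) (Ww : W w) : eventually (fun n =>
  (forall y, tail n y -> (w : grhom X Y) (winv Ww y) = y) /\
  (forall x, tail n x -> winv Ww ((w : grhom X Y) x) = x)).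
Proof. by rewrite /winv; case: cid => phi []. Qed.

Fixpoint germ (X Y : gr k Q) (z : zz X Y) : (X : fpgrmod k Q) -> (Y : fpgrmod k Q) :=
  match z in zigzag _ x y return (x : fpgrmod k Q) -> (y : fpgrmod k Q) with
  | zz_mor x y f => (f : grhom (x : fpgrmod k Q) (y : fpgrmod k Q))
  | zz_inv x y w Ww => winv Ww
  | zz_comp x y z g f => germ g \o germ f
  end.

Lemma germ_homgerm (X Y : gr k Q) (z : zz X Y) : homgerm (germ z).
Proof.
elim: z => /= [x y f|x y w Ww|x y z g Hg f Hf].
- exact: homgerm_grhom.
- exact: winv_homgerm.
exact: homgerm_comp.
Qed.

Lemma germ_sound (X Y : gr k Q) (z z' : zz X Y) :
  zz_eq z z' -> germ_eq (germ z) (germ z').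
Proof.
elim=> {X Y z z'} /=.
- by move=> x y f; apply: germ_eq_refl.
- by move=> x y f g _; apply: germ_eq_sym.
- by move=> x y f g h _ e _; apply: germ_eq_trans e.
- by move=> x y z g g' f f' _ eg _ ef; apply: germ_eq_comp eg ef; apply: germ_homgerm.
- by move=> x y z t h g f; apply: germ_eq_refl.
- by move=> x y f; apply: germ_eq_refl.
- by move=> x y f; apply: germ_eq_refl.
- by move=> x y f g e; apply: germ_eq_refl.
- by move=> x y z g f; apply: germ_eq_refl.
- by move=> x y w Ww; apply: eventually_imp (winvK Ww) => n [_ h] u tu; apply: h.
- by move=> x y w Ww; apply: eventually_imp (winvK Ww) => n [h _] u tu; apply: h.
Qed.

(** A germ defined on tail [n] is the roof formed by its restriction to that tail and the formal
    inverse of the tail inclusion. *)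
Lemma germ_full (X Y : gr k Q) (phi : (X : fpgrmod k Q) -> (Y : fpgrmod k Q)) :
  homgerm phi -> exists z : zz X Y, germ_eq (germ z) phi.
Proof.
move=> g; have [n Hn] := eventually_and g (eventually_fp_tail (X : fpgrmod k Q)).
have [h fpt] := Hn n (lexx n).
pose psi : mor (FpGrMod fpt : gr k Q) Y := restrict h.
exists (zz_comp (zz_mor _ psi) (zz_inv (tail_incl_iso_modulo fpt))).
apply: eventually_imp (winvK (tail_incl_iso_modulo fpt)) => m [wK _] x tx /=.
by rewrite -[in RHS](wK x tx).
Qed.

(* Every zigzag becomes an actual morphism after restriction to a small tail, by
   induction on the zigzag; this is what makes [germ] faithful. *)
Lemma germ_restrict (X Y : gr k Q) (z : zz X Y) : eventually (fun n =>
  forall (h : fp_tail (X : fpgrmod k Q) n) (psi : mor (FpGrMod h : gr k Q) Y),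
    (forall u, (psi : grhom (tail_mod (X : fpgrmod k Q) n) (Y : fpgrmod k Q)) u = germ z (val u)) ->
    zz_eq (zz_comp z (zz_mor W (tail_incl (X : fpgrmod k Q) n : mor (FpGrMod h : gr k Q) X)))
      (zz_mor W psi)).
Proof.
elim: z => {X Y} [X Y f|X Y w Ww|X Y Z g IHg f IHf].
- exists 0 => n _ h psi e; apply: zz_trans (zz_sym (zz_mor_comp _ _ _)) _.
  by apply: zz_mor_eq => u; rewrite e.
- apply: eventually_imp (winvK Ww) => n [wK _] h psi e.
  (* As [psi] computes the weak inverse, the tail inclusion is [w] after [psi]; then [w] cancels
     against its formal inverse. *)
  apply: (@zz_trans _ _ _ _ _ (zz_comp (zz_inv Ww) (zz_comp (zz_mor W w) (zz_mor W psi)))).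
    apply: zz_congr (zz_refl _) _; apply: zz_trans _ (zz_mor_comp _ _ _).
    by apply: zz_mor_eq => u /=; rewrite e wK //; apply: tval_tail.
  apply: zz_trans (zz_assoc _ _ _) _.
  exact: zz_trans (zz_congr (zz_invl Ww) (zz_refl _)) (zz_idl _).
have := eventually_and (eventually_and IHg IHf) (eventually_and
  (eventually_and (germ_homgerm g) (germ_homgerm f)) (eventually_fp_tail (Y : fpgrmod k Q))).
apply: eventually_imp => n [[Hg Hf] [[gg gf] fpY]] h psi e.
have ef := Hf h (restrict gf) (fun=> erefl).
have eg := Hg fpY (restrict gg) (fun=> erefl).
(* The restriction of [f] factors through tail [n] of [Y], where the induction hypothesis for [g]
   applies. *)
pose psi' : mor (FpGrMod h : gr k Q) (FpGrMod fpY : gr k Q) := corestrict gf.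
apply: zz_trans (zz_sym (zz_assoc _ _ _)) _.
apply: zz_trans (zz_congr (zz_refl _) ef) _.
have e1 : zz_eq (zz_mor W (restrict gf : mor (FpGrMod h : gr k Q) Y))
    (zz_comp (zz_mor W (tail_incl (Y : fpgrmod k Q) n : mor (FpGrMod fpY : gr k Q) Y)) (zz_mor W psi')).
  by apply: zz_trans _ (zz_mor_comp _ _ _); apply: zz_mor_eq => u.
apply: zz_trans (zz_congr (zz_refl _) e1) _.
apply: zz_trans (zz_assoc _ _ _) _.
apply: zz_trans (zz_congr eg (zz_refl _)) _.
apply: zz_trans (zz_sym (zz_mor_comp _ _ _)) _.
by apply: zz_mor_eq => u; rewrite e.
Qed.

(** On a common tail both zigzags become the same graded morphism, and the tail inclusion is
    cancelled by its formal inverse. *)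
Lemma germ_faithful (X Y : gr k Q) (z z' : zz X Y) :
  germ_eq (germ z) (germ z') -> zz_eq z z'.
Proof.
move=> e; have := eventually_and (eventually_and (germ_restrict z) (germ_restrict z'))
  (eventually_and (eventually_and (germ_homgerm z) e) (eventually_fp_tail (X : fpgrmod k Q))).
move=> [n /(_ n (lexx n))[[H H'] [[gz ez] fpX]]].
have e1 := H fpX (restrict gz) (fun=> erefl).
have e2 : zz_eq (zz_comp z' (zz_mor W (tail_incl (X : fpgrmod k Q) n : mor (FpGrMod fpX : gr k Q) X)))
    (zz_mor W (restrict gz : mor (FpGrMod fpX : gr k Q) Y)).
  by apply: (H' fpX (restrict gz)) => u; apply: ez; apply: tval_tail.
have {e2}e3 := zz_trans e1 (zz_sym e2).
have cancel (t : zz X Y) : zz_eq t (zz_comp (zz_comp t (zz_mor W (tail_incl (X : fpgrmod k Q) n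
    : mor (FpGrMod fpX : gr k Q) X))) (zz_inv (tail_incl_iso_modulo fpX))).
  apply: zz_trans (zz_sym (zz_idr _)) _; apply: zz_trans _ (zz_assoc _ _ _).
  exact: zz_congr (zz_refl _) (zz_sym (zz_invr _)).
apply: zz_trans (cancel z) _; apply: zz_trans _ (zz_sym (cancel z')).
exact: zz_congr e3 (zz_refl _).
Qed.

End Germs.

(** * Splitting *)

Section Splitting.
Variables (k : fieldType) (Q : quiver).
Local Notation kQ := (path_algebra k Q).
Local Notation fp X := (X : fpgrmod k Q).
Implicit Types (A B C T : qgr k Q).

Lemma qgr_eq A B (f g : mor A B) : germ_eq (germ f) (germ g) -> heq f g.
Proof. exact: germ_faithful. Qed.

Lemma qgr_eq_germ A B (f g : mor A B) : heq f g -> germ_eq (germ f) (germ g).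
Proof. exact: germ_sound. Qed.

Definition qgr0 A B : mor A B := zz_mor _ (grhom0 (fp A) (fp B) : @mor (gr k Q) A B).

Lemma germ_at0 A B (f : mor A B) : germ f 0 = 0.
Proof. by have [n /(_ n (lexx n)) h] := germ_homgerm f; apply: homgerm_at0 h. Qed.

Lemma qgr_zero_fp : is_zero_obj (zero_fp k Q : qgr k Q).
Proof.
split=> X.
  exists (qgr0 (zero_fp k Q) X) => g; apply: qgr_eq; exists 0 => n _ x _ /=.
  by rewrite (zero_mod_eq0 x) germ_at0.
exists (qgr0 X (zero_fp k Q)) => g; apply: qgr_eq; exists 0 => n _ x _.
exact: zero_mod_eq0.
Qed.

Lemma qgr_zeroP A B (f : mor A B) : is_zero_mor f <-> germ_eq (germ f) (fun=> 0).
Proof.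
split=> [[Z [[ZI _] [a [b e]]]]|f0].
  have [h Hh] := ZI Z.
  have ez := germ_eq_trans (qgr_eq_germ (Hh (idm Z))) (germ_eq_sym (qgr_eq_germ (Hh (qgr0 Z Z)))).
  apply: germ_eq_trans (qgr_eq_germ e) _.
  have := eventually_and ez (eventually_tail (germ_homgerm a)).
  apply: eventually_imp => n [z0 ta] x tx /=.
  by have := z0 _ (ta x tx) => /= ->; apply: germ_at0.
exists (zero_fp k Q); split; first exact: qgr_zero_fp.
exists (qgr0 A (zero_fp k Q)), (qgr0 (zero_fp k Q) B); apply: qgr_eq.
by apply: germ_eq_trans f0 _; apply: germ_eq_refl.
Qed.

(** Let [D] be the quotient of [C] by the image under [g] of a tail of [B]; it is finitely presented
    because that tail is finitely generated. The projection to [D] and the zero morphism agree after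
    [g], so they are equal in [qgr], and [D] vanishes in high degrees. *)
Lemma cokernel_surj A B C (f : mor A B) (g : mor B C) : is_cokernel f g ->
  eventually (fun n => forall z : fp C, tail n z -> exists2 y, tail n y & germ g y = z).
Proof.
move=> [/qgr_zeroP gf0 gU].
have [n Hn] := eventually_and (germ_homgerm g) (eventually_fp_tail (fp B)).
have {Hn}[gg fpB] := Hn n (lexx n).
have [s [h hP]] := @image_fg _ _ (FpGrMod fpB) (fp C) (restrict gg).
have fpq := quot_mod_fp (fpgr_fp (fp C)) hP.
pose D : qgr k Q := FpGrMod fpq.
pose N := @image _ _ (FpGrMod fpB) (fp C) (restrict gg).
pose p : mor C D := zz_mor _ (quot_hom N : @mor (gr k Q) C (FpGrMod fpq)).
have pg0 y : tail n y -> germ (compm p g) y = 0.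
  by move=> ty; apply: qlin_eq0; exists (intail ty).
have [|u [_ uU]] := gU D (compm p g).
  apply/qgr_zeroP; apply: eventually_imp (eventually_and gf0 (eventually_tail (germ_homgerm f))).
  by move=> m [e _] x tx; have := e x tx => /= ->; apply: qlin_eq0; apply: gsub0.
have ep := uU p (heq_refl _).
have e0 : heq (qgr0 C D) u.
  by apply: uU; apply: qgr_eq; exists n => m le y ty; rewrite pg0 //; apply: tail_le ty.
have [m Hm] := germ_eq_trans (qgr_eq_germ ep) (germ_eq_sym (qgr_eq_germ e0)).
exists (`|n| + `|m|) => d led; apply: tail_ind.
- by exists 0; [exact: tail0 | exact: germ_at0].
- move=> z z' [y ty <-] [y' ty' <-]; exists (y + y'); first exact: tailD.
  by rewrite (homgerm_at_add gg) //; apply: (@tail_le _ _ _ _ d) => //; lia.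
move=> e z lee dz.
have /qlin_eq0P[y ey] : qlin N z = 0 by apply: (Hm e) (tail_deg dz (lexx e)); lia.
have ty := tval_tail y.
exists (hcomp e (val y)); first exact: tail_deg (hcomp_deg _ _) lee.
by rewrite -(homgerm_at_hcomp gg) // -[germ g _]ey hcomp_id.
Qed.

Lemma hcomp_hpart (M : grmod k Q) (m : nat) (n : int) (c : kQ) (b : M) : gdeg n b ->
  hcomp (m%:Z + n) (c *: b) = hpart m c *: b.
Proof.
move=> db; have [L eL] := sum_hpart c.
have hD x y : hpart m (x + y) = hpart m x + hpart m y :> kQ.
  by have := pa_linP (fun p => if plen p == m then pa_basis k p else 0) 1 x y; rewrite !scale1r.
have h0 : hpart m (0 : kQ) = 0.
  by rewrite (hpart_homog m (@homog0 k Q m.+1)) eqn_leq ltnn andbF.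
rewrite {1}eL scaler_suml hcomp_bigsum {2}eL (big_morph _ hD h0) scaler_suml.
apply: eq_bigr => l _; rewrite (hpart_homog m (@homog_hpart _ _ l c)).
rewrite (hcomp_homog _ (gdegM (@homog_hpart _ _ l c) db)) (inj_eq (addIr n)) eqz_nat.
by case: ifP => //; rewrite scale0r.
Qed.

Lemma homgerm_at_sum (X Y : grmod k Q) n (phi : X -> Y) (I : Type) (r : seq I) (F : I -> X) :
  homgerm_at n phi -> (forall i, tail n (F i)) ->
  phi (\sum_(i <- r) F i) = \sum_(i <- r) phi (F i).
Proof.
move=> h tF; elim: r => [|i r IH]; first by rewrite !big_nil (homgerm_at0 h).
by rewrite !big_cons (homgerm_at_add h) ?IH //; apply: tail_sum.
Qed.

(** Projectivity of a tail of [Z]: the section is prescribed on the generators [b i] and extended by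
    coefficients. *)
Lemma germ_section (X Z : grmod k Q) (phi : X -> Z) : finitely_presented Z -> homgerm phi ->
  eventually (fun n => forall z, tail n z -> exists2 y, tail n y & phi y = z) ->
  exists2 sg : Z -> X, homgerm sg & germ_eq (phi \o sg) id.
Proof.
move=> fpZ gphi surj.
have [n Hn] := eventually_and (fp_free_tail fpZ) (eventually_and gphi surj).
have {Hn}[[r [b [v [bd bv bS free]]]] [gp sp]] := Hn n (lexx n).
have tb i : tail n (b i) by apply: tail_deg (bd i) (lexx n).
have [y0 Hy0] := choice (fun i => let: ex_intro2 y ty e := sp _ (tb i) in
  ex_intro (fun y => tail n y /\ phi y = b i) y (conj ty e)).
(* Projecting the lift to the degree and the vertex of [b i] does not change its image. *)
pose y i := idem k (v i) *: hcomp n (y0 i).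
have dy i : gdeg n (y i) by apply: gdegM0 (hcomp_deg _ _); apply: homog_idem.
have ty i : tail n (y i) by apply: tail_deg (dy i) (lexx n).
have phiy i : phi (y i) = b i.
  have [t0 e0] := Hy0 i; rewrite (homgerm_at_scale gp); last exact: tail_hcomp.
  by rewrite -(homgerm_at_hcomp gp) // e0 hcomp_id.
have iy i : idem k (v i) *: y i = y i by rewrite scalerA idem_idem eqxx.
clearbody y.
have ex z : exists c : 'I_r -> kQ, tail n z -> z = \sum_i c i *: b i.
  case: (pselect (tail n z)) => [/bS[c ->]|nz]; first by exists c.
  by exists (fun=> 0).
have [c Hc] := choice ex.
pose sg z := \sum_i c z i *: y i.
(* Independence of the chosen coefficients: two choices differ by elements that [idem (v i)] kills
   on the right, and [y i] is fixed by this idempotent. *)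
have sgE e : sg (\sum_i e i *: b i) = \sum_i e i *: y i.
  set z := \sum_i e i *: b i.
  have tz : tail n z by apply: tail_sum => i; apply: tailM.
  apply/eqP; rewrite -subr_eq0 -sumrB big1 // => i _.
  rewrite -scalerBl -(iy i) scalerA (free (fun i => c z i - e i)) ?scale0r //.
  under eq_bigr => j _ do rewrite scalerBl.
  by rewrite sumrB -Hc // subrr.
exists sg.
  apply: (@homgermP _ _ _ _ _ n); split=> [a z z' tz tz'|d z led dz].
    have -> : a *: z + z' = \sum_i (a * c z i + c z' i) *: b i.
      rewrite {1}(Hc z tz) {1}(Hc z' tz') scaler_sumr -big_split /=.
      by apply: eq_bigr => i _; rewrite [RHS]scalerDl scalerA.
    rewrite sgE scaler_sumr -big_split /=.
    by apply: eq_bigr => i _; rewrite scalerDl scalerA.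
  have [m ed] : exists m : nat, d = m%:Z + n by exists `|d - n|%N; lia.
  have tz : tail n z by apply: tail_deg dz led.
  (* The chosen coefficients need not be homogeneous; their parts of length [m] also represent [z]
     and show the degree of its image. *)
  have ez : z = \sum_i hpart m (c z i) *: b i.
    rewrite -[LHS](hcomp_id dz) {1}(Hc z tz) hcomp_bigsum ed.
    by apply: eq_bigr => i _; rewrite hcomp_hpart.
  rewrite ez sgE ed; apply: gdeg_sum => i; apply: gdegM (dy i).
  exact: homog_hpart.
exists n => m le z tz /=; have {}tz : tail n z by apply: tail_le tz.
rewrite (homgerm_at_sum _ gp) => [|i]; last exact: tailM.
rewrite [RHS](Hc z tz); apply: eq_bigr => i _.
by rewrite (homgerm_at_scale gp) ?phiy.
Qed.

Record split_at A B C n (F : fp A -> fp B) (G : fp B -> fp C) (S : fp C -> fp B)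
    (R : fp B -> fp A) : Prop := SplitAt {
  split_F : homgerm_at n F;
  split_G : homgerm_at n G;
  split_S : homgerm_at n S;
  split_R : homgerm_at n R;
  split_GS : forall x, tail n x -> G (S x) = x;
  split_GF : forall x, tail n x -> G (F x) = 0;
  split_RF : forall x, tail n x -> R (F x) = x;
  split_RS : forall x, tail n x -> R (S x) = 0;
  split_FR : forall x, tail n x -> x = F (R x) + S (G x) }.

(** The mediating morphisms are [f a + s b] for the product and [a r + b g] for the coproduct. These
    sums are formed on germs and brought back to [qgr] by [germ_full]; uniqueness comes from
    [split_FR]. *)
Lemma split_at_direct_sum A B C (f : mor A B) (g : mor B C) (s : mor C B) (r : mor B A) :
  eventually (fun n => split_at n (germ f) (germ g) (germ s) (germ r)) ->
  is_direct_sum f s r g.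
Proof.
move=> sp; split.
- by apply: qgr_eq; apply: eventually_imp sp => n h x; apply: split_RF h x.
- by apply: qgr_eq; apply: eventually_imp sp => n h x; apply: split_GS h x.
- by apply/qgr_zeroP; apply: eventually_imp sp => n h x; apply: split_GF h x.
- by apply/qgr_zeroP; apply: eventually_imp sp => n h x; apply: split_RS h x.
split=> T a b.
  have gu : homgerm (fun x => germ f (germ a x) + germ s (germ b x)).
    by apply: homgerm_add; apply: homgerm_comp; apply: germ_homgerm.
  have [u Hu] := germ_full gu; exists u.
  have := eventually_and sp (eventually_and Hu
    (eventually_and (eventually_tail (germ_homgerm a)) (eventually_tail (germ_homgerm b)))).
  move=> {sp Hu} ev; split.
    split; apply: qgr_eq; apply: eventually_imp ev => n [h [eu [ta tb]]] x tx /=;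
      have tf := homgerm_at_tail (split_F h) (lexx n) (ta x tx);
      have ts := homgerm_at_tail (split_S h) (lexx n) (tb x tx); rewrite eu //.
      rewrite (homgerm_at_add (split_R h)) //.
      by rewrite (split_RF h) ?(split_RS h) ?addr0 //; [apply: tb|apply: ta].
    rewrite (homgerm_at_add (split_G h)) //.
    by rewrite (split_GF h) ?(split_GS h) ?add0r //; [apply: tb|apply: ta].
  move=> u' /qgr_eq_germ ea /qgr_eq_germ eb; apply: qgr_eq.
  have := eventually_and ev (eventually_and (eventually_and ea eb) (eventually_tail (germ_homgerm u'))).
  apply: eventually_imp => n [[h [eu _]] [[ea' eb'] tu]] x tx.
  by rewrite eu // -ea' // -eb' // [LHS](split_FR h) //; apply: tu.
have gu : homgerm (fun x => germ a (germ r x) + germ b (germ g x)).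
  by apply: homgerm_add; apply: homgerm_comp; apply: germ_homgerm.
have [u Hu] := germ_full gu; exists u.
have := eventually_and sp (eventually_and Hu
  (eventually_and (germ_homgerm a) (germ_homgerm b))).
move=> {sp Hu} ev; split.
  split; apply: qgr_eq; apply: eventually_imp ev => n [h [eu [ga gb]]] x tx /=.
    rewrite eu; last exact: (homgerm_at_tail (split_F h)).
    by rewrite (split_RF h) // (split_GF h) // germ_at0 addr0.
  rewrite eu; last exact: (homgerm_at_tail (split_S h)).
  by rewrite (split_RS h) // (split_GS h) // germ_at0 add0r.
move=> u' /qgr_eq_germ ea /qgr_eq_germ eb; apply: qgr_eq.
have := eventually_and ev (eventually_and (eventually_and ea eb) (germ_homgerm u')).
apply: eventually_imp => n [[h [eu _]] [[ea' eb'] gu']] x tx.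
have tr : tail n (germ r x) by apply: (homgerm_at_tail (split_R h)).
have tg : tail n (germ g x) by apply: (homgerm_at_tail (split_G h)).
rewrite eu // {1}(split_FR h tx) (homgerm_at_add gu'); first by rewrite -ea' // -eb'.
  exact: (homgerm_at_tail (split_F h)).
exact: (homgerm_at_tail (split_S h)).
Qed.

(** Both [u] and [u'] factor the same morphism through the kernel, and the factorization is
    unique. *)
Lemma kernel_mono A B C T (f : mor A B) (g : mor B C) (u u' : mor T A) :
  is_kernel f g -> germ_eq (germ f \o germ u) (germ f \o germ u') -> heq u u'.
Proof.
move=> [/qgr_zeroP gf0 fU] e.
have [|w [_ wU]] := fU T (compm f u').
  apply/qgr_zeroP; have := eventually_and gf0 (eventually_tail (germ_homgerm u')).
  by apply: eventually_imp => n [h tu] x tx; apply: h; apply: tu.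
apply: heq_trans (heq_sym (wU u' (heq_refl _))).
by apply: wU; apply: qgr_eq.
Qed.

End Splitting.

Theorem proposition1p5 (k : fieldType) (Q : quiver) (A B C : qgr k Q)
    (f : mor A B) (g : mor B C) :
  short_exact f g -> splits f g.
Proof.
move=> [fk gc]; have [/qgr_zeroP gf0 fU] := fk.
have [sg gsg gsK] := germ_section (fpgr_fp (C : fpgrmod k Q)) (germ_homgerm g) (cokernel_surj gc).
have [s Hs] := germ_full gsg.
have gsK' : germ_eq (germ g \o germ s) id.
  apply: germ_eq_trans gsK; apply: germ_eq_comp => //; first exact: germ_homgerm.
  exact: germ_eq_refl.
(* The germ of [1 - s g] is killed by [g], so it factors through the kernel; the factor [r]
   satisfies [f r = 1 - s g]. *)
have gt : homgerm (fun x => x + - germ s (germ g x)).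
  apply: homgerm_add; first exact: (@homgerm_grhom _ _ _ _ (grhom_id (B : fpgrmod k Q))).
  by apply/homgerm_opp/homgerm_comp; apply: germ_homgerm.
have [t Ht] := germ_full gt.
have [|r [/qgr_eq_germ er _]] := fU B t.
  apply/qgr_zeroP; have := eventually_and (eventually_and (germ_homgerm g) (germ_homgerm s))
    (eventually_and Ht gsK').
  apply: eventually_imp => n [[gg gs] [et gK]] x tx /=; have tg := homgerm_at_tail gg (lexx n) tx.
  rewrite et // (homgerm_at_add gg) ?(homgerm_at_opp gg) //; last exact/tailN/(homgerm_at_tail gs).
    by rewrite [germ g (germ s _)]gK // subrr.
  exact: (homgerm_at_tail gs).
exists s, r; apply: split_at_direct_sum.
have ev : eventually (fun n => [/\ homgerm_at n (germ f), homgerm_at n (germ g), homgerm_at n (germ s),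
    homgerm_at n (germ r) & (forall x, tail n x -> germ g (germ s x) = x) /\
    (forall x, tail n x -> germ g (germ f x) = 0) /\
    (forall x, tail n x -> germ f (germ r x) = x - germ s (germ g x))]).
  have := eventually_and (eventually_and (germ_homgerm f) (germ_homgerm g))
    (eventually_and (eventually_and (germ_homgerm s) (germ_homgerm r))
       (eventually_and gsK' (eventually_and gf0 (germ_eq_trans er Ht)))).
  by apply: eventually_imp => n [[? ?] [[? ?] [? [? ?]]]]; split.
(* This identity and the next are checked after the monomorphism [f]: [f r f = f - s g f = f] and
   [f r s = s - s g s = 0]. *)
have rf : heq (compm r f) (idm A).
  apply: (kernel_mono fk); apply: eventually_imp ev => n [gf gg gs gr [gK [gf' fr]]] x tx /=.
  rewrite fr; last exact: (homgerm_at_tail gf).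
  by rewrite gf' // germ_at0 subr0.
have rs : heq (compm r s) (qgr0 C A).
  apply: (kernel_mono fk); apply: eventually_imp ev => n [gf gg gs gr [gK [gf' fr]]] x tx /=.
  rewrite fr; last exact: (homgerm_at_tail gs).
  by rewrite gK // subrr germ_at0.
have := eventually_and ev (eventually_and (qgr_eq_germ rf) (qgr_eq_germ rs)).
apply: eventually_imp => n [[gf gg gs gr [gK [gf' fr]]] [rf' rs']]; split=> //.
by move=> x tx; rewrite fr // subrK.
Qed.
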